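(* Let $p\in(0,1)$, $q=1-p$, and $D\sim\mathcal D_p$. (a) ($\epsilon$-fractional loss.) There exist constants $\epsilon_0,c>0$ such that, for every constant $0<\epsilon<\epsilon_0$ and every integer $d$ satisfying $$d\ge\frac{\log(1/\epsilon)+c\,\epsilon\log^2(1/\epsilon)}{\log(1/q)},$$ a random $d$-regular graph $G\sim\mathcal G(n,d)$ satisfies $$\lim_{n\to\infty}\mathbb P_G\{L(G)\le\epsilon n\}=1.$$ (b) (Constant loss.) For every fixed constant $\delta>0$ and all sufficiently large $n$, if $$d\ge\frac{(1+\delta)\log n}{\log(1/q)},$$ then a random $d$-regular graph $G\sim\mathcal G(n,d)$ satisfies $\mathbb E_G[L(G)]=O(n^{-\delta/8})$. Consequently, $$\mathbb P_G\{L(G)\le n^{-\delta/16}\}\ge 1-O(n^{-\delta/16}).$$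
   Context: $\mathcal G(n,d)$ (configuration model): on vertex set $[n]$ with $nd$ assumed even, attach $d$ half-edges to each vertex, pair all $nd$ half-edges uniformly at random, and merge each pair into an edge (self-loops and multi-edges may occur; they do not affect matching sizes). Limits in $n$ are along $n$ with $nd$ even. Under $\mathcal D_p$, the demands $D_j$, $j\in[n]$, are independent (and independent of $G$), each equal to $1/2$ with probability $p$ and $1$ with probability $q=1-p$. Let $\mathrm{supp}(D)=\{j:D_j=1/2\}$ and let $G[\mathrm{supp}(D)]$ be the induced subgraph. $\mu(H)$ is the maximum matching size of $H$ (matchings never use self-loops). With $K_n$ the complete graph, $L(G,D)=2\bigl(\mu(K_n[\mathrm{supp}(D)])-\mu(G[\mathrm{supp}(D)])\bigr)$ and $L(G)=\mathbb E_{D\sim\mathcal D_p}[L(G,D)]$ (expectation over $D$ only). The $O(\cdot)$ constants depend only on the fixed parameters $p,\delta$. *)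

(* Defs.v *)
From HB Require Import structures.
From mathcomp Require Import all_boot all_order all_algebra.
From mathcomp Require Import all_classical all_reals all_analysis.

Set Implicit Arguments.
Unset Strict Implicit.
Unset Printing Implicit Defensive.

Import Order.TTheory GRing.Theory Num.Theory.
Import numFieldNormedType.Exports.

Local Open Scope ring_scope.

Section Graphs.
Variable V : finType.

(* A multigraph on V enters only through its adjacency relation, since parallel
   edges never change a matching size.  [G v v] may hold (a self-loop at v);
   matchings ignore it. *)

Definition complete_graph : rel V := [rel u v | u != v].

(* Vertices outside S are kept, but isolated. *)
Definition induced (G : rel V) (S : {set V}) : rel V :=
  [rel u v | [&& u \in S, v \in S & G u v]].

Definition is_matching (G : rel V) (M : {set {set V}}) : bool :=
  finset.trivIset M &&
  [forall e in M, [exists u, [exists v,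
     [&& u != v, G u v & e == [set u; v]%SET]]]].

Definition max_matching (G : rel V) : nat :=
  \max_(M : {set {set V}} | is_matching G M) #|M|.

End Graphs.

Section Loss.
Variables (R : realType) (n : nat).
Implicit Types (G : rel 'I_n) (D : 'I_n -> R).

Definition demand_supp D : {set 'I_n} := [set j | D j == 2^-1]%SET.

Definition loss G D : R :=
  2 * ((max_matching (induced (@complete_graph _) (demand_supp D)))%:R
       - (max_matching (induced G (demand_supp D)))%:R).

(* Outcome w of n independent coin tosses: [w j] is true, with probability p,
   when the demand of j is 1/2. *)
Definition demand_of (w : {ffun 'I_n -> bool}) : 'I_n -> R :=
  fun j => if w j then 2^-1 else 1.

Definition demand_expectation (p : R) (f : ('I_n -> R) -> R) : R :=
  \sum_(w : {ffun 'I_n -> bool})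
     (\prod_(j < n) (if w j then p else 1 - p)) * f (demand_of w).

Definition mean_loss (p : R) G : R := demand_expectation p (loss G).

End Loss.

Section ConfigurationModel.
Variables n d : nat.

(* (v, i) is the i-th half-edge attached to the vertex v. *)
Definition half_edge : finType := ('I_n * 'I_d)%type.

(* A pairing of the half-edges is a fixed-point-free involution, sending each
   half-edge to its partner. *)
Definition pairings : {set {ffun half_edge -> half_edge}} :=
  [set s : {ffun half_edge -> half_edge} |
    [forall h, (s h != h) && (s (s h) == h)]]%SET.

Definition pairing_graph (s : {ffun half_edge -> half_edge}) : rel 'I_n :=
  [rel u v | [exists i, [exists j, s (u, i) == (v, j)]]].

Variable R : realType.

(* Both vanish when n * d is odd, as there are then no pairings. *)
Definition cm_expectation (f : rel 'I_n -> R) : R :=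
  (\sum_(s in pairings) f (pairing_graph s)) / #|pairings|%:R.

Definition cm_probability (A : pred (rel 'I_n)) : R :=
  #|[set s in pairings | A (pairing_graph s)]%SET|%:R / #|pairings|%:R.

End ConfigurationModel.

(* Main.v *)
From HB Require Import structures.
From mathcomp Require Import all_classical all_reals all_analysis.
From mathcomp Require Import all_boot all_order all_algebra.
From mathcomp Require Import zify ring lra.
Require Import Defs.

Set Implicit Arguments.
Unset Strict Implicit.
Unset Printing Implicit Defensive.

Import Order.TTheory GRing.Theory Num.Theory.
Import numFieldNormedType.Exports.

(** By the Tutte-Berge formula, the deficiency of G[S], S = supp D, is at most
    |R| - |U| where the vertices of R lie in different components of G[S] - U.
    Call a vertex of S low when it has fewer than d / g half-edges into S, for a
    large constant g.  With high probability every small set of non-low vertices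
    expands threefold in S and any two linear-size sets are joined by an edge;
    then all but one of the components are small, and the only sources of
    deficiency are the isolated vertices, and the low vertices with another low
    vertex within distance four.  A vertex is isolated with probability about
    p q^d, while two given vertices are both low with probability at most
    q^(7d/4); there are at most (d + 1)^4 vertices within distance four, so the
    expected loss is at most n p q^d (1 + o(1)) as d grows.  As q^d <= epsilon,
    the factor p < 1 leaves room for the error in (a), and the expected number
    of isolated vertices is at most about n^(-delta) in (b).

    All properties of G needed are union bounds over the exposure of the
    partners of a set of half-edges. *)

(** The two sources of randomness are used one after the other. The conditions on the pairing
    quantify over all vertex sets and never mention S, so one typical pairing serves every demand;
    the demands are then averaged with the pairing fixed. Lowness links the two, and it is measured
    on half-edges, so that exposures control it.

    The unit of all exponents is [a = q^(1/16)]. A set [C] of distinct vertices contains few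
    vertices of S with probability at most [a^(15 #|C|)], up to a correction [a^(-d0)], where [d0]
    half-edges are used at each vertex. Fewer than [d0 / 15] of the [2 d0] half-edges at two given
    vertices are wasted on repeated vertices, so the exponent for two low vertices is 15 * 29/15 - 1
    = 28 sixteenths per half-edge, the 7/4 above.

    The one large component may leave an extra vertex unmatched. This is harmless for a loss of
    order n, but not for a loss tending to zero; there it disappears because the loss is even. *)

Section FunctionMatching.
Variables (V : finType) (e : rel V).
Implicit Types (S C U : {set V}) (f g h : {ffun V -> V}).

(** A matching is encoded as an involution fixing the unmatched vertices. Two matchings then compose
    to a permutation whose orbits give the alternating paths, and self-loops drop out because only
    moved points need an edge. *)
Definition fmatching S f : bool :=
  [forall x, f (f x) == x] && [forall x, (f x != x) ==> (x \in S) && e x (f x)].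

Definition missed S f : {set V} := [set x in S | f x == x].

Definition optimal S f : bool :=
  fmatching S f &&
  [forall g, fmatching S g ==> (#|missed S f| <= #|missed S g|)].

Lemma fmatchingP S f :
  reflect ((forall x, f (f x) = x) /\
           (forall x, f x != x -> (x \in S) && e x (f x)))
          (fmatching S f).
Proof.
apply: (iffP andP) => -[H1 H2]; split.
- by move=> x; apply/eqP/(forallP H1).
- by move=> x; apply/implyP/(forallP H2).
- by apply/forallP => x; apply/eqP/H1.
- by apply/forallP => x; apply/implyP/H2.
Qed.

Lemma optimalP S f :
  reflect (fmatching S f /\
           forall g, fmatching S g -> #|missed S f| <= #|missed S g|)
          (optimal S f).
Proof.
apply: (iffP andP) => -[H1 H2]; split=> //.
- by move=> g; apply/implyP/(forallP H2).
- by apply/forallP => g; apply/implyP/H2.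
Qed.

Lemma exists_optimal S : exists f, optimal S f.
Proof.
have id_m : fmatching S [ffun x => x].
  by apply/fmatchingP; split=> x; rewrite !ffunE ?eqxx.
case: (arg_minnP (fun f => #|missed S f|) id_m) => f fm fmin.
by exists f; apply/optimalP.
Qed.

Definition edge_sets f : {set {set V}} :=
  [set [set x; f x] | x in [set x | f x != x]].

Lemma edge_sets_partition S f : fmatching S f ->
  partition (edge_sets f) [set x | f x != x].
Proof.
move=> /fmatchingP[ff _]; apply/and3P; split.
- apply/eqP/setP => x; apply/bigcupP/idP.
    move=> [_ /imsetP[y ym ->]]; rewrite !inE in ym * => /orP[] /eqP-> //.
    by rewrite ff eq_sym.
  move=> xm; exists [set x; f x]; first by apply/imsetP; exists x.
  by rewrite !inE eqxx.
- apply/trivIsetP => _ _ /imsetP[x _ ->] /imsetP[y _ ->] neq.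
  rewrite -setI_eq0; apply/eqP/setP => z; rewrite !inE.
  apply/negP => /andP[/orP[]/eqP-> /orP[]/eqP E]; move/eqP: neq; apply.
  + by rewrite E.
  + by rewrite E ff setUC.
  + by rewrite -{1}[x]ff E setUC.
  + by rewrite E -[x]ff E ff.
- by apply/imsetP => -[x _ /setP/(_ x)]; rewrite !inE eqxx.
Qed.

Lemma card_edge_sets S f : fmatching S f ->
  #|[set x | f x != x]| = #|edge_sets f| * 2.
Proof.
move=> fm; apply: (card_uniform_partition _ (edge_sets_partition fm)).
by move=> _ /imsetP[x + ->]; rewrite inE cards2 eq_sym => ->.
Qed.

Lemma card_missed S f : fmatching S f ->
  #|S| = #|edge_sets f| * 2 + #|missed S f|.
Proof.
move=> fm; rewrite -(card_edge_sets fm).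
rewrite -(cardsID [set x | f x != x] S); congr (_ + _); apply: eq_card => x.
  rewrite !inE; case: eqP => //=; rewrite ?andbF // => /eqP fx.
  by move/fmatchingP: fm => [_ /(_ x fx)] /andP[->].
by rewrite !inE negbK andbC.
Qed.

Lemma edge_sets_matching S f : symmetric e -> fmatching S f ->
  is_matching (induced e S) (edge_sets f).
Proof.
move=> esym fm; have /and3P[_ ti _] := edge_sets_partition fm.
apply/andP; split=> //; apply/forallP => E; apply/implyP => /imsetP[x].
rewrite inE => fx ->; apply/existsP; exists x; apply/existsP; exists (f x).
have /fmatchingP[ff fe] := fm.
have /andP[xS xfx] := fe _ fx.
have /andP[fxS _] : (f x \in S) && e (f x) (f (f x)).
  by apply: fe; rewrite ff eq_sym.
by apply/and3P; split=> //; [rewrite eq_sym | apply/and3P].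
Qed.

Lemma max_matching_missed S f : symmetric e -> fmatching S f ->
  #|S| <= (max_matching (induced e S)).*2 + #|missed S f|.
Proof.
move=> esym fm; rewrite (card_missed fm) muln2 leq_add2r leq_double.
exact: (@leq_bigmax_cond _ _ (fun M : {set {set V}} => #|M|)
          _ (edge_sets_matching esym fm)).
Qed.

(** * Gallai's lemma *)

Definition splice C f g : {ffun V -> V} :=
  [ffun x => if x \in C then g x else f x].

Lemma splice_matching S C f g : fmatching S f -> fmatching S g ->
  {in C, forall x, f x \in C} -> {in C, forall x, g x \in C} ->
  fmatching S (splice C f g).
Proof.
move=> /fmatchingP[ff fe] /fmatchingP[gg ge] fC gC.
have fC' x : x \notin C -> f x \notin C.
  by apply: contra => /fC; rewrite ff.
apply/fmatchingP; split=> x; rewrite !ffunE; case: (boolP (x \in C)) => xC.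
- by rewrite (gC _ xC) gg.
- by rewrite (negbTE (fC' _ xC)) ff.
- exact: ge.
- exact: fe.
Qed.

Lemma card_missed_splice S C f g :
  #|missed S (splice C f g)| = #|missed S g :&: C| + #|missed S f :\: C|.
Proof.
rewrite -(cardsID C (missed S (splice C f g))).
by congr (_ + _); apply: eq_card => x; rewrite !inE ffunE; case: (x \in C);
   rewrite ?andbF ?andbT.
Qed.

(** The opposite splice, [f] on [C] and [g] elsewhere, cannot beat [g], so [g] misses no more points
    of [C] than [f] does; hence putting [g] on [C] does not worsen [f]. *)
Lemma splice_optimal S C f g : optimal S f -> optimal S g ->
  {in C, forall x, f x \in C} -> {in C, forall x, g x \in C} ->
  optimal S (splice C f g).
Proof.
move=> /optimalP[fm fo] /optimalP[gm go] fC gC.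
have hm := splice_matching fm gm fC gC.
have := go _ (splice_matching gm fm gC fC).
rewrite card_missed_splice -{1}(cardsID C (missed S g)) leq_add2r => le1.
apply/optimalP; split=> // k km; apply: leq_trans (fo _ km).
by rewrite card_missed_splice -(cardsID C (missed S f)) leq_add2r.
Qed.

(** * Alternating paths as orbits of a product of two involutions *)

Section Orbit.
Variables (f g : V -> V).
Hypotheses (ff : involutive f) (gg : involutive g).
Variable t : V.
Hypothesis gt : g t = t.

Let r x := g (f x).

Let r_inj : injective r.
Proof. exact: inj_comp (inv_inj gg) (inv_inj ff). Qed.

(** [f] conjugates [r] to its inverse, and [r (f t) = g t = t]. Thus the orbit of [t] is closed
    under [f] and [g]: it is the alternating path that starts at [t]. *)
Let iter_f_iter k : iter k.+1 r (f (iter k r t)) = t.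
Proof.
elim: k => [|k IHk]; first by rewrite /= /r ff.
rewrite iterSr; have -> : r (f (iter k.+1 r t)) = f (iter k r t).
  by rewrite iterS /r ff gg.
exact: IHk.
Qed.

Lemma fconnect_involutive_l x : fconnect r t x -> fconnect r t (f x).
Proof.
move=> /iter_findex <-; rewrite fconnect_sym //; set k := findex r t x.
by have := fconnect_iter r k.+1 (f (iter k r t)); rewrite iter_f_iter.
Qed.

Lemma fconnect_involutive_r x : fconnect r t x -> fconnect r t (g x).
Proof.
move=> /fconnect_involutive_l /connect_trans -> //.
have -> : g x = r (f x) by rewrite /r ff.
exact: fconnect1.
Qed.

(* A fixed point r^i t of f satisfies r^(2i+1) t = t, so two of them, with
   k = j - i, give r^(2k) t = t, whence r^k t = r^(k (2i+1)) t = t. *)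
Lemma fconnect_involutive_fixed u v :
  fconnect r t u -> fconnect r t v -> f u = u -> f v = v -> u = v.
Proof.
move=> /iter_findex; set i := findex r t u => <-.
move=> /iter_findex; set j := findex r t v => <- fi fj.
wlog le_ij : i j fi fj / i <= j => [hw|].
  by case/orP: (leq_total i j) => /hw ->.
have period k : f (iter k r t) = iter k r t -> iter (k.*2.+1) r t = t.
  by move=> fk; have := iter_f_iter k; rewrite fk -iterD addSn addnn.
have /period pi := fi; have /period pj := fj.
set k := j - i.
have p2k : iter k.*2 r t = t.
  have : iter (j.*2.+1) r t = t by [].
  by rewrite (_ : j.*2.+1 = k.*2 + i.*2.+1) ?iterD ?pi //; lia.
have iterM c m : iter c r t = t -> iter (m * c) r t = t.
  by move=> pc; elim: m => // m IHm; rewrite mulSn iterD IHm.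
have pk : iter k r t = t.
  have := iterM _ k pi.
  by rewrite (_ : k * i.*2.+1 = k + i * k.*2) ?iterD ?iterM //; lia.
by rewrite -{1}pk -iterD subnKC.
Qed.

End Orbit.

(** The relation of Gallai's proof. It holds along edges and passes through any vertex that some
    optimal matching misses, so it spreads over a component all of whose vertices can be missed; an
    optimal matching then misses at most one vertex there. *)
Definition linked S u v : Prop :=
  u = v \/ forall f, optimal S f -> ~ (f u = u /\ f v = v).

(** Suppose an optimal [f] misses distinct [u] and [v]. The alternating path from [t] holds at most
    one fixed point of [f], so it avoids [u] or [v]; switching to [g] along it gives an optimal
    matching that misses [t] together with that vertex. *)
Lemma linked_trans S t u v g : optimal S g -> g t = t ->
  linked S u t -> linked S t v -> linked S u v.
Proof.
move=> go gt; case=> [->//|Hu]; case=> [<-|Hv]; first by right.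
have [->|neq_uv] := eqVneq u v; [by left | right=> f fo [fu fv]].
have /optimalP[/fmatchingP[ff _] _] := fo.
have /optimalP[/fmatchingP[gg _] _] := go.
pose C := [set x | fconnect (fun x => g (f x)) t x].
have ho : optimal S (splice C f g).
  apply: splice_optimal => // x; rewrite !inE.
    exact: fconnect_involutive_l.
  exact: fconnect_involutive_r.
have ht : splice C f g t = t by rewrite ffunE inE connect0.
have fixed w : f w = w -> w \notin C -> splice C f g w = w.
  by move=> fw wC; rewrite ffunE (negbTE wC).
have [uC|uC] := boolP (u \in C); last by apply: (Hu _ ho); rewrite ht fixed.
have [vC|vC] := boolP (v \in C); last by apply: (Hv _ ho); rewrite ht fixed.
move/eqP: neq_uv; apply.
by rewrite !inE in uC vC; apply: (fconnect_involutive_fixed ff gg gt).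
Qed.

Lemma linked_adj S x y : symmetric e -> x \in S -> y \in S -> e x y ->
  linked S x y.
Proof.
move=> esym xS yS xy; have [->|neq] := eqVneq x y; [by left | right].
move=> f /optimalP[fm fo] [fx fy].
pose h : {ffun V -> V} := [ffun z => if z == x then y else if z == y then x else f z].
have /fmatchingP[ff fe] := fm.
have hm : fmatching S h.
  apply/fmatchingP; split=> z; rewrite !ffunE.
    case: (eqVneq z x) => [->|zx]; first by rewrite eqxx eq_sym (negbTE neq).
    case: (eqVneq z y) => [->|zy]; first by rewrite eqxx.
    have -> : (f z == x) = false.
      by apply/negP => /eqP E; move/eqP: zx; apply; rewrite -[z]ff E.
    have -> : (f z == y) = false.
      by apply/negP => /eqP E; move/eqP: zy; apply; rewrite -[z]ff E.
    by rewrite ff.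
  case: (eqVneq z x) => [->|zx]; first by rewrite xS xy.
  case: (eqVneq z y) => [->|zy]; first by rewrite yS esym xy.
  exact: fe.
suff : missed S h \proper missed S f by move/proper_card; rewrite ltnNge fo.
apply/properP; split.
  apply/subsetP => z; rewrite !inE ffunE.
  case: (eqVneq z x) => [->|zx]; first by rewrite eq_sym (negbTE neq) andbF.
  by case: (eqVneq z y) => [->|zy //]; rewrite (negbTE neq) andbF.
by exists x; rewrite !inE xS ?fx ?eqxx // ffunE eqxx eq_sym.
Qed.

Lemma linked_connect S x y : symmetric e ->
  {in S, forall t, exists2 g, optimal S g & g t = t} ->
  x \in S -> connect (induced e S) x y -> linked S x y.
Proof.
move=> esym miss xS /connectP[p pth ->] {y}.
elim/last_ind: p pth => [|p z IHp] /=; first by left.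
rewrite rcons_path last_rcons => /andP[/IHp lk /and3P[lS zS lz]].
have [g go gl] := miss _ lS.
exact: (linked_trans go gl lk (linked_adj esym lS zS lz)).
Qed.

(** * A weak form of the Tutte-Berge formula *)

(* U is a Tutte-Berge barrier; R has one vertex in each of |missed| + |U|
   components of the graph induced on S :\: U. *)
Lemma exists_barrier S f : symmetric e -> optimal S f ->
  exists U R : {set V}, [/\ U \subset S, R \subset S :\: U,
    #|missed S f| + #|U| <= #|R| &
    {in R &, forall x y, connect (induced e (S :\: U)) x y -> x = y}].
Proof.
move=> esym; have [k] := ubnP #|S|; elim: k S f => // k IHk S f Sk fo.
have [/exists_inP[a aS never]|] :=
  boolP [exists a in S, [forall g, optimal S g ==> (g a != a)]]; last first.
  (* Every vertex of [S] can be missed: by Gallai's argument the missed vertices of [f] lie in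
     different components, and the empty barrier suffices. *)
  move=> /exists_inPn miss.
  have {}miss : {in S, forall t, exists2 g, optimal S g & g t = t}.
    move=> t /miss /forallPn[g]; rewrite negb_imply negbK => /andP[go /eqP gt].
    by exists g.
  exists set0, (missed S f); split.
  - exact: sub0set.
  - by rewrite setD0; apply/subsetP => x; rewrite inE => /andP[].
  - by rewrite cards0 addn0.
  - move=> x y; rewrite !inE setD0 => /andP[xS /eqP fx] /andP[yS /eqP fy].
    move=> /(linked_connect esym miss xS) [//|/(_ _ fo)].
    by case.
have [f' fo'] := exists_optimal (S :\ a).
have Sa : #|S| = #|S :\ a|.+1 by rewrite (cardsD1 a S) aS.
have [|U [R [US RS cR dR]]] := IHk _ f' _ fo'; first by rewrite -ltnS -Sa.
have /optimalP[fm' _] := fo'.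
have /fmatchingP[ff' fe'] := fm'.
have fm'S : fmatching S f'.
  apply/fmatchingP; split=> // x /fe'; rewrite in_setD1.
  by move=> /andP[/andP[_ ->] ->].
have f'a : f' a = a.
  by apply/eqP; apply: contraT => /fe'; rewrite in_setD1 eqxx.
have /optimalP[fm fmin] := fo.
have lt_f' : #|missed S f| < #|missed S f'|.
  rewrite ltnNge; apply/negP => le.
  move/forallP/(_ f'): never; rewrite f'a eqxx implybF => /negP; apply.
  by apply/optimalP; split=> // g /fmin; apply: leq_trans.
(* Both numbers of missed vertices in [S] have the parity of [#|S|], so the strict inequality
   [lt_f'] is a gap of two: one accounts for [a] itself, the other pays for putting [a] into the
   barrier. *)
have := card_missed fm; have := card_missed fm'S; have := card_missed fm'.
rewrite Sa => E1 E2 E3.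
exists (a |: U), R.
have aU : a \notin U.
  by apply/negP => /(subsetP US); rewrite !inE eqxx.
have SaU : S :\: (a |: U) = (S :\ a) :\: U by rewrite setDDl.
split; rewrite ?SaU //.
  by apply/subUsetP; rewrite sub1set; split=> //; apply: subset_trans US (subsetDl _ _).
by rewrite cardsU1 aU; lia.
Qed.

End FunctionMatching.

(** * Deficiency of a graph whose low-degree vertices are scattered *)

Section Structure.
Variables (V : finType) (G : rel V).
Hypothesis Gsym : symmetric G.

Definition enlarge (X : {set V}) : {set V} :=
  X :|: [set v | [exists x in X, G x v]].

(** Radius four is what [missed_le] needs: two low vertices, each joined to a barrier vertex, where
    these barrier vertices share a neighbour, are ends of a walk of length four. *)
Definition ball4 v : {set V} := iter 4 enlarge [set v].

Definition nbrs (S A : {set V}) : {set V} :=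
  [set v in S :\: A | [exists x in A, G x v]].

Definition isolated (S : {set V}) : {set V} :=
  [set v in S | [forall u in S, (u != v) ==> ~~ G v u]].

Definition clustered (L : {set V}) : {set V} :=
  [set v in L | [exists u in L, (u != v) && (u \in ball4 v)]].

Lemma enlarge_mem (X : {set V}) x : x \in X -> x \in enlarge X.
Proof. by rewrite inE => ->. Qed.

Lemma enlarge_adj (X : {set V}) x y : x \in X -> G x y -> y \in enlarge X.
Proof. by move=> xX xy; rewrite !inE; apply/orP; right; apply/exists_inP; exists x. Qed.

Lemma ball4_1 v x : G v x -> x \in ball4 v.
Proof. by move=> vx; do 3!apply: enlarge_mem; apply: enlarge_adj vx; rewrite inE. Qed.

Lemma ball4_2 v x y : G v x -> G x y -> y \in ball4 v.
Proof.
move=> vx xy; do 2!apply: enlarge_mem; apply: (enlarge_adj _ xy).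
by apply: enlarge_adj vx; rewrite inE.
Qed.

Lemma ball4_4 v x y z u : G v x -> G x y -> G y z -> G z u -> u \in ball4 v.
Proof.
move=> vx xy yz zu; apply: (enlarge_adj _ zu); apply: (enlarge_adj _ yz).
by apply: (enlarge_adj _ xy); apply: enlarge_adj vx; rewrite inE.
Qed.

Lemma clusteredPn (L : {set V}) v u :
  v \in L :\: clustered L -> u \in L -> u \in ball4 v -> u = v.
Proof.
rewrite in_setD => /andP[vc vL] uL uv; apply: contraNeq vc => neq.
by rewrite [_ \in clustered _]inE vL; apply/exists_inP; exists u; rewrite ?neq.
Qed.

Lemma leq_card_rel (T U : finType) (X : {set T}) (Y : {set U}) (r : T -> U -> bool) :
  {in X, forall x, exists2 y, y \in Y & r x y} ->
  (forall x x' y, x \in X -> x' \in X -> y \in Y -> r x y -> r x' y -> x = x') ->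
  #|X| <= #|Y|.
Proof.
move=> ex inj; pose f x := [pick y in Y | r x y].
have fP x : x \in X -> exists2 y, f x = Some y & (y \in Y) && r x y.
  move=> /ex[y yY ry]; rewrite /f; case: pickP => [z|/(_ y)]; first by exists z.
  by rewrite yY ry.
rewrite -(card_in_imset (f := f) (D := X)); last first.
  move=> x x' xX x'X E; have [y fy /andP[yY ry]] := fP _ xX.
  have [y' fy' /andP[_ ry']] := fP _ x'X.
  by move: E ry'; rewrite fy fy' => -[<-]; apply: inj.
have some_inj : injective (@Some U) by move=> ? ? [].
rewrite -(card_imset (mem Y) some_inj); apply/subset_leq_card/subsetP.
move=> _ /imsetP[x /fP[y -> /andP[yY _]] ->].
by apply/imsetP; exists y.
Qed.

(** * Components of an induced subgraph *)

Section Components.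
Variable Z : {set V}.
Let H := induced G Z.

Lemma induced_sym : symmetric H.
Proof. by move=> x y; rewrite /H /induced /= Gsym andbCA. Qed.

Lemma connect_induced_in x y : x \in Z -> connect H x y -> y \in Z.
Proof.
move=> xZ /connectP[p pth ->]; elim/last_ind: p pth => [//|p z _].
by rewrite rcons_path last_rcons => /andP[_ /and3P[]].
Qed.

(* A closed set of least size among those with at least m elements exceeds m
   by more than m, so removing the component of one of its points leaves fewer
   than m elements. *)
Lemma large_component m :
  (forall X Y : {set V}, [disjoint X & Y] -> m <= #|X| -> m <= #|Y| ->
     exists x y, [/\ x \in X, y \in Y & G x y]) ->
  0 < m -> 3 * m <= #|Z| ->
  exists2 r, r \in Z & #|Z :\: [set x | connect H r x]| < m.
Proof.
move=> H2 m0 mZ.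
have no_edge (Q : {set V}) : Q \subset Z ->
    (forall x y, x \in Q -> H x y -> y \in Q) -> m <= #|Q| -> #|Z :\: Q| < m.
  move=> QZ Qcl mQ; rewrite ltnNge; apply/negP => mQ'.
  have [|x [y [xQ]]] := H2 Q (Z :\: Q) _ mQ mQ'.
    by rewrite -setI_eq0 setIDA setDIl setDv set0I.
  rewrite inE => /andP[/negP yQ yZ] xy; apply: yQ; apply: (Qcl x) => //.
  by rewrite /H /induced /= (subsetP QZ _ xQ) yZ.
pose P (Q : {set V}) := [&& Q \subset Z,
  [forall x in Q, [forall y, H x y ==> (y \in Q)]] & m <= #|Q|].
have PP Q : P Q -> [/\ Q \subset Z,
    (forall x y, x \in Q -> H x y -> y \in Q) & m <= #|Q|].
  move=> /and3P[QZ /forall_inP cl mQ]; split=> // x y /cl/forallP/(_ y)/implyP.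
  exact.
have PZ : P Z.
  apply/and3P; split=> //; last lia.
  by apply/forall_inP => x _; apply/forallP => y; apply/implyP => /and3P[].
case: (arg_minnP (fun Q : {set V} => #|Q|) PZ) => Q /PP[QZ Qcl mQ] Qmin.
have := no_edge Q QZ Qcl mQ; have := cardsID Q Z; rewrite (setIidPr QZ) => cQ lQ.
have /card_gt0P[r rQ] : 0 < #|Q| by lia.
have rZ := subsetP QZ _ rQ.
exists r => //; set K := [set x | connect H r x].
have KZ : K \subset Z.
  by apply/subsetP => x; rewrite inE; apply: connect_induced_in.
apply: no_edge => // [x y|].
  by rewrite !inE => rx /connect1; apply: connect_trans.
rewrite leqNgt; apply/negP => Km.
have mQK : m <= #|Q :\: K|.
  have := cardsID K Q; have : #|Q :&: K| <= #|K| by rewrite subset_leq_card ?subsetIr.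
  by lia.
have : P (Q :\: K).
  apply/and3P; split=> //; first exact: subset_trans (subsetDl _ _) QZ.
  apply/forall_inP => x; rewrite !inE => /andP[xK xQ]; apply/forallP => y.
  apply/implyP => xy; rewrite !inE (Qcl x y) // andbT; apply: contra xK => ry.
  by apply: (connect_trans ry); rewrite connect1 // induced_sym.
move/Qmin; rewrite leqNgt => /negP; apply; apply: proper_card.
by apply/properP; split; [apply: subsetDl | exists r; rewrite // !inE connect0].
Qed.

End Components.

(** The representatives in [R] are charged as follows. One, for the large component, gives the
    successor. Those in [Ra], whose component contains a non-low vertex, are charged to [N]. The
    others are isolated, clustered, or in [Rd]; the last have distinct neighbours [M] in the
    barrier. Expansion gives [#|N| <= #|U :\: M| + #|C|], so [Ra] and [Rd] together cost at most
    [#|U| + #|C|], and [#|U|] cancels against the barrier inequality. *)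
Lemma missed_le (S L : {set V}) m f :
  L \subset S -> 0 < m -> 6 * m <= #|S| ->
  (forall A : {set V}, A \subset S :\: L -> A != set0 -> #|A| <= m ->
     3 * #|A| <= #|nbrs S A|) ->
  (forall X Y : {set V}, [disjoint X & Y] -> m <= #|X| -> m <= #|Y| ->
     exists x y, [/\ x \in X, y \in Y & G x y]) ->
  optimal G S f -> #|missed S f| <= (#|isolated S| + 2 * #|clustered L|).+1.
Proof.
move=> LS m0 mS H1 H2 /(exists_barrier Gsym)[U [R [US RZ cR dR]]].
set Z := S :\: U in RZ dR; set H := induced G Z in dR.
have Hsym : connect_sym H by apply/sym_connect_sym/induced_sym.
have cZ : #|Z| = #|S| - #|U| by rewrite cardsDS.
have cUS : #|U| <= #|S| by rewrite subset_leq_card.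
have cRZ : #|R| <= #|Z| by rewrite subset_leq_card.
(* As [#|U| <= #|R| <= #|S| - #|U|], the barrier is at most half of [S], and [6 * m] leaves [3 * m]
   vertices in [Z]. *)
have [|r0 r0Z small] := @large_component Z m H2 m0; first by lia.
set K := [set x | connect H r0 x] in small.
pose A := Z :\: K.
have AH x y : x \in A -> H x y -> y \in A.
  rewrite !inE => /andP[xK xZ] xy; have /and3P[_ yZ _] := xy.
  rewrite inE in yZ; rewrite yZ andbT.
  apply: contra xK => r0y; apply: (connect_trans r0y).
  by rewrite connect1 // /H induced_sym.
have AC x y : x \in A -> connect H x y -> y \in A.
  move=> xA /connectP[p pth ->]; elim/last_ind: p pth => [//|p z IHp].
  by rewrite rcons_path last_rcons => /andP[/IHp lA]; apply: AH.
have AZ : A \subset Z by apply: subsetDl.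
have ZS : Z \subset S by apply: subsetDl.
pose R1 := R :&: A.
have cR1 : #|R| <= #|R1|.+1.
  rewrite -(cardsID A R) -addn1 leq_add2l; apply/card_le1_eqP => x y.
  have AK z : z \in R -> z \notin A -> connect H r0 z.
    by move=> /(subsetP RZ) zZ; rewrite in_setD zZ andbT negbK inE.
  move=> /setDP[xR /(AK _ xR) xA] /setDP[yR /(AK _ yR) yA].
  by apply: dR => //; move: yA; rewrite Hsym => /connect_trans; apply.
pose N := A :\: L; pose C := clustered L.
pose Ra := [set r in R1 | [exists x in N, connect H r x]].
pose Rd := R1 :\: (Ra :|: isolated S :|: C).
have cRa : #|Ra| <= #|N|.
  apply: (@leq_card_rel _ _ _ _ (connect H)).
    by move=> r; rewrite inE => /andP[_ /exists_inP[x xN rx]]; exists x.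
  move=> r r' x; rewrite !(inE, in_setI) =>
    /andP[/andP[rR _] _] /andP[/andP[r'R _] _] _ rx r'x.
  by apply: dR => //; move: r'x; rewrite Hsym; apply: connect_trans rx.
have RdP r : r \in Rd -> [/\ r \in L :\: C & exists2 y, y \in U & G r y].
  move=> /setDP[rR1]; rewrite !in_setU !negb_or => /andP[/andP[rRa rI] rC].
  have /setIP[rR rA] := rR1.
  have rS := subsetP ZS _ (subsetP RZ _ rR).
  have noN x : connect H r x -> x \in N -> False.
    move=> rx xN; move/negP: rRa; apply; rewrite inE rR1.
    by apply/exists_inP; exists x.
  have CL x : connect H r x -> x \in L.
    move=> rx; apply: contraT => xL; case: (noN x rx).
    by rewrite inE xL (AC _ _ rA).
  have rLC : r \in L :\: C by rewrite inE rC CL ?connect0.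
  split=> //.
  move: rI; rewrite [_ \in isolated _]inE rS /= => /forall_inPn[y yS].
  rewrite negb_imply negbK => /andP[yr ry]; exists y => //.
  (* A neighbour outside the barrier would lie in the component of [r], hence be low, and be too
     close to the unclustered [r]. *)
  apply: contraT => yU; move/eqP: yr; case.
  apply: (clusteredPn rLC _ (ball4_1 ry)); apply/CL/connect1.
  by rewrite /H /induced /= (subsetP AZ _ rA) ry /Z inE yU yS.
(* The default is never taken on [Rd]. *)
pose mt r := odflt r [pick y in U | G r y].
have mtP r : r \in Rd -> (mt r \in U) /\ G r (mt r).
  move=> /RdP[_ [y yU ry]]; rewrite /mt; case: pickP => [z /andP[]|/(_ y)] //.
  by rewrite yU ry.
pose M := mt @: Rd.
have near r r' : r \in Rd -> r' \in Rd -> r' \in ball4 r -> r = r'.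
  move=> /RdP[rL _] /RdP[r'L _] rr'; apply/esym/(clusteredPn rL) => //.
  by move: r'L; rewrite inE => /andP[].
have cM : #|M| = #|Rd|.
  apply: card_in_imset => r r' rR r'R E; apply: near => //.
  have [_ r1] := mtP _ rR; have [_ r2] := mtP _ r'R.
  by apply: (ball4_2 r1); rewrite E Gsym.
have MU : M \subset U by apply/subsetP => _ /imsetP[r /mtP[rU _] ->].
have cUM : #|U :\: M| = #|U| - #|M| by rewrite cardsDS.
have cMU : #|M| <= #|U| by rewrite subset_leq_card.
have cN : #|N| <= #|U :\: M| + #|C|.
  have [->|N0] := eqVneq N set0; first by rewrite cards0.
  have NSL : N \subset S :\: L by apply: setSD; apply: subset_trans AZ ZS.
  have cNm : #|N| <= m.
    by apply: ltnW; apply: leq_ltn_trans small; rewrite subset_leq_card ?subsetDl.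
  (* Origin of the threefold expansion: up to [#|N|] neighbours may lie in [M] (walks of length
     four) and up to [#|N|] may be unclustered low vertices (walks of length two), so at least
     [#|N|] remain in [U :\: M] or [C]. *)
  have := H1 N NSL N0 cNm; set B := nbrs S N.
  have sub : B \subset (U :\: M) :|: (M :&: B) :|: C :|: ((L :\: C) :&: B).
    apply/subsetP => y yB; rewrite !in_setU !in_setI !in_setD yB !andbT.
    have := yB; rewrite inE => /andP[/setDP[yS yN] /exists_inP[x xN xy]].
    have [yU|yU] /= := boolP (y \in U); first by case: (y \in M).
    have yA : y \in A.
      have xA : x \in A by move: xN; rewrite inE => /andP[].
      apply: (AH x) => //; rewrite /H /induced /= (subsetP AZ _ xA) xy.
      by rewrite /Z inE yU yS.
    have -> : y \in L by move: yN; rewrite inE yA andbT negbK.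
    by case: (y \in C); rewrite ?orbT.
  have c1 : #|M :&: B| <= #|N|.
    apply: (@leq_card_rel _ _ _ _ G) => [y|y y' x].
      by rewrite inE => /andP[_]; rewrite inE => /andP[_ /exists_inP[x xN xy]];
         exists x; rewrite 1?Gsym.
    move=> /setIP[/imsetP[r rR ->] _] /setIP[/imsetP[r' r'R ->] _] xN rx r'x.
    congr mt; apply: near => //.
    have [_ r1] := mtP _ rR; have [_ r2] := mtP _ r'R.
    by apply: (ball4_4 r1 rx); rewrite 1?Gsym; eassumption.
  have c2 : #|(L :\: C) :&: B| <= #|N|.
    apply: (@leq_card_rel _ _ _ _ G) => [y|y y' x].
      by rewrite inE => /andP[_]; rewrite inE => /andP[_ /exists_inP[x xN xy]];
         exists x; rewrite 1?Gsym.
    move=> /setIP[yL _] /setIP[y'L _] xN yx y'x.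
    apply/esym/(clusteredPn yL); first by move: y'L; rewrite inE => /andP[].
    by apply: (ball4_2 yx); rewrite Gsym.
  have := subset_leq_card sub.
  have := (leq_card_setU (U :\: M :|: M :&: B :|: C) ((L :\: C) :&: B)).1.
  have := (leq_card_setU (U :\: M :|: M :&: B) C).1.
  have := (leq_card_setU (U :\: M) (M :&: B)).1.
  by move=> u1 u2 u3 u4; lia.
have cR1' : #|R1| <= #|Ra| + #|isolated S| + #|C| + #|Rd|.
  have sub : R1 \subset (Ra :|: isolated S :|: C) :|: Rd.
    by apply/subsetP => x xR; rewrite /Rd in_setU in_setD xR andbT orbN.
  have := subset_leq_card sub.
  have := (leq_card_setU (Ra :|: isolated S :|: C) Rd).1.
  have := (leq_card_setU (Ra :|: isolated S) C).1.
  have := (leq_card_setU Ra (isolated S)).1.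
  by move=> u1 u2 u3 u4; lia.
rewrite -/C; lia.
Qed.

End Structure.

Import Order.TTheory GRing.Theory Num.Theory.

(** * From missed vertices to the loss *)

Section LossBounds.

Lemma max_matching_complete (V : finType) (S : {set V}) :
  (max_matching (induced (@complete_graph V) S)).*2 <= #|S|.
Proof.
rewrite -geq_half_double; apply/bigmax_leqP => M /andP[ti /forallP edge].
rewrite geq_half_double -muln2.
have card2 : {in M, forall E : {set V}, #|E| = 2}.
  move=> E EM; move/implyP/(_ EM): (edge E).
  by move=> /existsP[u /existsP[v /and3P[uv _ /eqP->]]]; rewrite cards2 uv.
rewrite -(@card_uniform_partition _ 2 M (cover M)) //; last first.
  by rewrite /partition eqxx ti /=; apply/negP => /card2; rewrite cards0.
apply/subset_leq_card/bigcupsP => E EM; move/implyP/(_ EM): (edge E).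
move=> /existsP[u /existsP[v /and3P[_ /and3P[uS vS _] /eqP->]]].
by apply/subsetP => x; rewrite !inE => /orP[] /eqP->.
Qed.

Local Open Scope ring_scope.

Variables (R : realType) (n : nat) (G : rel 'I_n) (D : 'I_n -> R).
Let S := demand_supp D.

Lemma loss_le_missed (f : {ffun 'I_n -> 'I_n}) : symmetric G ->
  fmatching G S f -> loss G D <= #|missed S f|%:R.
Proof.
move=> Gsym /(max_matching_missed Gsym); have := max_matching_complete S.
rewrite /loss -/S; set K := max_matching (induced (@complete_graph _) S).
set m := max_matching (induced G S) => leK leS; clearbody K m.
have : (K.*2 <= m.*2 + #|missed S f|)%N by exact: leq_trans leK leS.
by move=> le_K; rewrite mulrBr lerBlDr -!natrM -natrD ler_nat !mul2n addnC.
Qed.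

(** The loss is bounded by an even integer that is at most [b + 1]. For [b = 0] it therefore
    vanishes, and otherwise [b + 1 <= 2 b]. This trades the additive one for a factor two. *)
Lemma loss_le_double (f : {ffun 'I_n -> 'I_n}) b : symmetric G ->
  fmatching G S f -> (#|missed S f| <= b.+1)%N -> loss G D <= b.*2%:R.
Proof.
move=> Gsym /(max_matching_missed Gsym); have := max_matching_complete S.
rewrite /loss -/S; set K := max_matching (induced (@complete_graph _) S).
set m := max_matching (induced G S) => leK leS le_b; clearbody K m.
have : (K.*2 <= m.*2 + b.*2)%N.
  by move: #|S| #|missed S f| leK leS le_b => x y; lia.
by move=> le_K; rewrite mulrBr lerBlDr -!natrM -natrD ler_nat !mul2n addnC.
Qed.

Lemma loss_le_size : loss G D <= n%:R.
Proof.
have := max_matching_complete S.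
rewrite /loss -/S; set K := max_matching (induced (@complete_graph _) S).
set m := max_matching (induced G S) => leK; clearbody K m.
have : (K.*2 <= n)%N by rewrite (leq_trans leK) // -[X in (_ <= X)%N]card_ord max_card.
move=> le_K; rewrite mulrBr lerBlDr -!natrM -natrD ler_nat !mul2n.
by rewrite (leq_trans le_K) ?leq_addr.
Qed.

End LossBounds.

Lemma demand_supp_of (R : realType) n (w : {ffun 'I_n -> bool}) :
  demand_supp (demand_of R w) = [set j | w j].
Proof.
apply/setP => j; rewrite !inE /demand_of; case: (w j); first by rewrite eqxx.
by apply/negbTE/eqP => E; have := @ltr01 R; lra.
Qed.

(** * Uniform random pairings *)

Lemma leq_sub_add2 a b x y : a <= b.+2 -> x <= y -> a - y <= 2 + (b - x).
Proof. by lia. Qed.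

Section Pairings.
Variable T : finType.
Implicit Types (H F A : {set T}) (s : {ffun T -> T}) (h : T).

(* The pairings of H, extended by the identity outside H. *)
Definition pairs H : {set {ffun T -> T}} :=
  [set s : {ffun T -> T} | [forall h, (s (s h) == h) && ((s h != h) == (h \in H))]].

Lemma pairsP H s :
  reflect ((forall h, s (s h) = h) /\ (forall h, (s h != h) = (h \in H)))
          (s \in pairs H).
Proof.
rewrite inE; apply: (iffP forallP) => [E|[E1 E2] h]; last by rewrite E1 E2 !eqxx.
by split=> h; have /andP[/eqP ? /eqP ?] := E h.
Qed.

Lemma card_setD2 H h h' : h \in H -> h' \in H :\ h ->
  #|H :\ h :\ h'| = #|H| - 2.
Proof. by move=> hH h'H; rewrite (cardsD1 h H) hH (cardsD1 h' (H :\ h)) h'H addnA addKn. Qed.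

Lemma leq_card_setD2 F h h' : #|F| <= #|F :\ h :\ h'|.+2.
Proof.
rewrite (cardsD1 h F) (cardsD1 h' (F :\ h)).
by rewrite addnA -add2n leq_add2r (leq_add (leq_b1 _) (leq_b1 _)).
Qed.

Definition join h h' s : {ffun T -> T} :=
  [ffun x => if x == h then h' else if x == h' then h else s x].

Definition unjoin h h' s : {ffun T -> T} :=
  [ffun x => if (x == h) || (x == h') then x else s x].

(** Sorting the pairings by the partner of [h]; deleting that pair leaves an arbitrary pairing of
    the rest. This is the exposure of one half-edge. *)
Lemma sum_exposure (M : nmodType) H h (g : {ffun T -> T} -> M) : h \in H ->
  (\sum_(s in pairs H) g s =
   \sum_(h' in H :\ h) \sum_(s in pairs (H :\ h :\ h')) g (join h h' s))%R.
Proof.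
move=> hH.
rewrite (partition_big (fun s => s h) (mem (H :\ h))) /=; last first.
  move=> s /pairsP[ss sH]; rewrite in_setD1 sH hH /=.
  by rewrite -sH ss eq_sym sH.
apply: eq_bigr => h'; rewrite in_setD1 => /andP[h'h h'H].
rewrite (reindex_onto (join h h') (unjoin h h')) /=; last first.
  move=> s /andP[/pairsP[ss sH] /eqP sh]; apply/ffunP => x; rewrite !ffunE.
  case: eqP => [->|_] //=; case: eqP => [->|_] //.
  by rewrite -sh ss.
apply: eq_bigl => s; apply/idP/idP.
  move=> /andP[/andP[/pairsP[ss sH] _] /eqP us].
  have sE x : s x = if (x == h) || (x == h') then x else join h h' s x.
    by rewrite -[LHS]/(s x) -{1}us ffunE.
  have sh : s h = h by rewrite sE eqxx.
  have sh' : s h' = h' by rewrite sE eqxx orbT.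
  apply/pairsP; split=> x.
    have := ss x; rewrite !ffunE.
    case: (eqVneq x h) => [->|xh]; first by rewrite !sh.
    case: (eqVneq x h') => [->|xh']; first by rewrite !sh'.
    case: (eqVneq (s x) h) => [E|_]; first by move=> E'; rewrite E' eqxx in xh'.
    by case: (eqVneq (s x) h') => [E E'|//]; rewrite E' eqxx in xh.
  rewrite !in_setD1; have := sH x; rewrite ffunE.
  case: (eqVneq x h) => [->|xh]; first by rewrite sh eqxx andbF.
  by case: (eqVneq x h') => [->|xh']; first by rewrite sh' eqxx.
move=> /pairsP[ss sH].
have sh : s h = h by apply/eqP; rewrite -[_ == _]negbK sH !in_setD1 eqxx andbF.
have sh' : s h' = h' by apply/eqP; rewrite -[_ == _]negbK sH !in_setD1 eqxx.
apply/andP; split; last first.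
  apply/eqP/ffunP => x; rewrite !ffunE.
  case: (eqVneq x h) => [->|xh]; first by rewrite sh.
  by case: (eqVneq x h') => [->|xh'].
rewrite [join h h' s h]ffunE !eqxx andbT; apply/pairsP; split=> x; rewrite !ffunE.
  case: (eqVneq x h) => [->|xh]; first by rewrite (negbTE h'h) eqxx.
  case: (eqVneq x h') => [->|xh']; first by rewrite eqxx.
  case: (eqVneq (s x) h) => [E|_]; first by rewrite -(ss x) E sh eqxx in xh.
  case: (eqVneq (s x) h') => [E|_]; first by rewrite -(ss x) E sh' eqxx in xh'.
  exact: ss.
case: (eqVneq x h) => [->|xh]; first by rewrite h'h hH.
case: (eqVneq x h') => [->|xh']; first by rewrite eq_sym h'h h'H.
by rewrite sH !in_setD1 xh xh'.
Qed.

(** The double factorial [(n - 1)!!] for even [n], and 0 for odd [n]. *)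
Fixpoint npairs n : nat := if n is m.+2 then m.+1 * npairs m else (n == 0).

Lemma card_pairs H : #|pairs H| = npairs #|H|.
Proof.
have [n] := ubnP #|H|; elim: n H => // n IHn H; rewrite ltnS => Hn.
have [->|[h hH]] := set_0Vmem H.
  rewrite cards0 /= -(cards1 [ffun x : T => x]); apply: eq_card => s.
  rewrite [RHS]inE; apply/idP/eqP => [/pairsP[_ sH]|->].
    by apply/ffunP => x; rewrite ffunE; apply/eqP; rewrite -[_ == _]negbK sH inE.
  by apply/pairsP; split=> x; rewrite !ffunE // eqxx inE.
have cH := cardsD1 h H; rewrite hH add1n in cH.
rewrite -sum1_card (sum_exposure _ hH).
rewrite (eq_bigr (fun=> npairs (#|H| - 2))); last first.
  move=> h' h'H; rewrite sum1_card IHn (card_setD2 hH h'H) //.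
  by rewrite cH in Hn *; lia.
rewrite sum_nat_const cH; case: #|H :\ h| => [|m]; first by rewrite mul0n.
by rewrite (_ : m.+2 - 2 = m) //; lia.
Qed.

Lemma npairs_gt0 n : ~~ odd n -> 0 < npairs n.
Proof.
have [m] := ubnP n; elim: m n => // m IHm [|[|n]] //=.
by rewrite negbK => nm on; rewrite muln_gt0 IHm //; lia.
Qed.

Local Open Scope ring_scope.
Variable R : realFieldType.

(** Averaging conditional bounds [c] over the [#|H| - 1] equally likely partners of [h], with
    denominators cleared so that a single half-edge is no exception. *)
Lemma sum_exposure_le H h (g : {ffun T -> T} -> R) (c : T -> R) : h \in H ->
  (forall h', h' \in H :\ h ->
     \sum_(s in pairs (H :\ h :\ h')) g (join h h' s) <=
       c h' * (npairs (#|H| - 2))%:R) ->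
  \sum_(s in pairs H) g s * (#|H| - 1)%:R <= (\sum_(h' in H :\ h) c h') * #|pairs H|%:R.
Proof.
move=> hH le; rewrite -mulr_suml (sum_exposure _ hH) card_pairs.
have cH := cardsD1 h H; rewrite hH add1n in cH.
case: (posnP #|H :\ h|) => [c0|].
  by rewrite cH c0 subnn mulr0 (cards0_eq c0) big_set0 mul0r.
rewrite cH; case: #|H :\ h| cH => // m cH _.
have -> : npairs m.+2 = (m.+1 * npairs m)%N by [].
rewrite natrM mulrCA mulrC subn1 ler_pM2l ?ltr0n //.
rewrite mulr_suml; apply: ler_sum => h' /le.
by rewrite cH -addn2 addnK.
Qed.

(* Each exposure uses up at most two elements of F, and, as F lies in A, removes
   two elements from A; (a - 1) / (n - 1) <= a / n for a <= n. *)
Lemma sum_pairs_stay e H F A : F \subset A -> A \subset H -> (2 * e <= #|F|)%N ->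
  \sum_(s in pairs H | [forall x in F, s x \in A]) 1 <=
    (#|A|%:R / #|H|%:R) ^+ e * #|pairs H|%:R :> R.
Proof.
elim: e H F A => [|e IHe] H F A FA AH eF.
  rewrite expr0 mul1r -sum1_card natr_sum.
  rewrite [leRHS](bigID (fun s : {ffun T -> T} => [forall x in F, s x \in A])) /=.
  by rewrite lerDl sumr_ge0.
have /card_gt0P[h hF] : (0 < #|F|)%N by lia.
have hA := subsetP FA _ hF; have hH := subsetP AH _ hA.
have cAH : (#|A| <= #|H|)%N by rewrite subset_leq_card.
have cFA : (#|F| <= #|A|)%N by rewrite subset_leq_card.
have H1 : 0 < (#|H| - 1)%:R :> R by rewrite ltr0n; lia.
rewrite big_mkcondr /= -(ler_pM2r H1) mulr_suml.
pose b : R := (#|A| - 2)%:R / (#|H| - 2)%:R.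
have b0 : 0 <= b by rewrite divr_ge0.
pose c h' : R := if h' \in A :\ h then b ^+ e else 0.
have := @sum_exposure_le H h (fun s => if [forall x in F, s x \in A] then 1 else 0) c hH.
move=> /(_ _)/le_trans; apply.
  move=> h' h'H; rewrite /c; case: ifPn => h'A; last first.
    rewrite mul0r big1 // => s _; case: ifPn => // /forall_inP/(_ h hF).
    rewrite ffunE eqxx => h'A'; move: h'A h'H; rewrite !in_setD1 h'A' andbT.
    by move=> /negbTE ->.
  rewrite -big_mkcondr /=.
  rewrite -(card_setD2 hH h'H) -card_pairs.
  have -> : b = #|A :\ h :\ h'|%:R / #|H :\ h :\ h'|%:R.
    by rewrite /b (card_setD2 hH h'H) (card_setD2 hA h'A).
  have FA' : F :\ h :\ h' \subset A :\ h :\ h' by rewrite !setSD.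
  have AH' : A :\ h :\ h' \subset H :\ h :\ h' by rewrite !setSD.
  have eF' : (2 * e <= #|F :\ h :\ h'|)%N.
    by rewrite -2!ltnS (leq_trans _ (leq_card_setD2 F h h')) // -addn2 -mulnSr.
  apply: le_trans (IHe _ _ _ FA' AH' eF').
  rewrite [leLHS]big_mkcondr [leRHS]big_mkcondr /=; apply: ler_sum => s.
  move=> /pairsP[ss sH]; case: ifPn; last by case: ifP.
  move=> /forall_inP sF; case: ifPn => // /negP[]; apply/forall_inP => x.
  rewrite !in_setD1 => /and3P[xh' xh xF]; have := sF x xF.
  rewrite ffunE (negbTE xh) (negbTE xh') => ->; rewrite andbT.
  have sx (z : T) : s z = z -> x != z -> s x != z.
    by move=> sz; apply: contraNneq => E; rewrite -(ss x) E sz.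
  have fixd z : z \notin H :\ h :\ h' -> s z = z.
    by move=> zH; apply/eqP; rewrite -[_ == _]negbK sH.
  by rewrite !sx ?fixd // !in_setD1 eqxx ?andbF.
rewrite mulrAC; apply: ler_wpM2r; first by [].
have -> : \sum_(h' in H :\ h) c h' = (#|A| - 1)%:R * b ^+ e.
  rewrite -big_mkcondr /= (eq_bigl (mem (A :\ h))) => [|x]; last first.
    by rewrite /= !in_setD1; case: (eqVneq x h) => //= _;
       case: (boolP (x \in A)) => xA; rewrite ?andbF // (subsetP AH).
  by rewrite sumr_const mulr_natl [in RHS](cardsD1 h A) hA add1n subn1.
have A1 : (0 < #|A|)%N by lia.
have HR : 0 < #|H|%:R :> R by rewrite ltr0n; lia.
rewrite exprSr -mulrA mulrC; apply: ler_pM.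
- by rewrite exprn_ge0.
- by [].
- apply: lerXn2r; rewrite ?nnegrE ?divr_ge0 //.
  rewrite /b; case: (posnP (#|H| - 2)) => [->|H2]; first by rewrite invr0 mulr0 divr_ge0.
  rewrite ler_pdivrMr ?ltr0n // mulrAC ler_pdivlMr // -!natrM ler_nat.
  by rewrite mulnBr mulnBl leq_sub2l // mulnC leq_mul2l cAH orbT.
- rewrite mulrAC ler_pdivlMr // -!natrM ler_nat.
  by rewrite mulnBr mulnBl muln1 mul1n leq_sub2l.
Qed.

(** * Vertices met more than once by an exposure *)

Section Repeats.
Variables (V : finType) (vert : T -> V) (d : nat).
Hypothesis fiber : forall v, (#|[set h | vert h == v]| <= d)%N.
Implicit Type W : {set V}.

Definition landing s F : {set V} := [set vert (s x) | x in F].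

Lemma card_preim_le H W : (#|[set h in H | vert h \in W]| <= #|W| * d)%N.
Proof.
rewrite -sum1_card (partition_big vert (mem W)) /=; last first.
  by move=> h; rewrite inE => /andP[].
rewrite -sum_nat_const; apply: leq_sum => v _.
rewrite sum1_card; apply: leq_trans (fiber v); apply/subset_leq_card/subsetP.
by move=> h; rewrite !inE => /andP[].
Qed.

Lemma landing_join_sub h h' s F F' :
  F' \subset F -> h \notin F' -> h' \notin F' ->
  landing s F' \subset landing (join h h' s) F.
Proof.
move=> F'F hF' h'F'; apply/subsetP => _ /imsetP[x xF' ->].
apply/imsetP; exists x; first exact: (subsetP F'F).
rewrite ffunE; case: eqP => [E|_]; first by rewrite -E xF' in hF'.
by case: eqP => [E|_] //; rewrite -E xF' in h'F'.
Qed.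

(* The exponent counts the elements of F that lead to no new vertex.  Exposing
   the partner of an element of F costs a factor lam^2 when the partner sits on
   a vertex seen before, which happens with probability at most rho. *)
Lemma sum_pairs_repeat H F W (lam rho : R) :
  F \subset H -> {in F, forall x, vert x \in W} -> 1 <= lam -> 0 <= rho ->
  (#|W| + #|F|)%:R * d%:R <= rho * (#|H|%:R - 2 * #|F|%:R) ->
  \sum_(s in pairs H) lam ^+ (#|F| - #|landing s F :\: W|) <=
    (1 + lam ^+ 2 * rho) ^+ #|F| * #|pairs H|%:R.
Proof.
move=> + + lam1 rho0.
have [k] := ubnP #|F|; elim: k H F W => // k IHk H F W; rewrite ltnS => Fk FH FW hyp.
have lam0 : 0 <= lam by apply: le_trans lam1.
have base1 : 1 <= 1 + lam ^+ 2 * rho by rewrite lerDl mulr_ge0 ?exprn_ge0.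
have [F0|/card_gt0P[h hF]] := posnP #|F|.
  rewrite F0 expr0 mul1r (eq_bigr (fun=> 1)) => [|s _]; last by rewrite sub0n.
  by rewrite sumr_const.
have hH := subsetP FH _ hF.
have [p0|p0] := posnP #|pairs H|.
  by rewrite (cards0_eq p0) big_set0 cards0 mulr0.
have H2 : (1 < #|H|)%N.
  move: p0; rewrite card_pairs; have : (0 < #|H|)%N by apply/card_gt0P; exists h.
  by case: #|H| => [|[|]].
have cF := cardsD1 h F; rewrite hF add1n in cF.
have H1 : 0 < (#|H| - 1)%:R :> R by rewrite ltr0n subn_gt0.
pose X := (1 + lam ^+ 2 * rho) ^+ #|F :\ h|.
have X0 : 0 <= X by rewrite exprn_ge0 // (le_trans ler01).
pose c h' := (if vert h' \in W then lam ^+ 2 else 1) * X.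
have cF1 : #|F|%:R = #|F :\ h|%:R + 1 :> R by rewrite cF -natr1.
have cH2 h' : h' \in H :\ h -> #|H :\ h :\ h'|%:R = #|H|%:R - 2 :> R.
  by move=> h'H; rewrite (card_setD2 hH h'H) natrB.
rewrite -(ler_pM2r H1) mulr_suml.
have := @sum_exposure_le H h (fun s => lam ^+ (#|F| - #|landing s F :\: W|)) c hH.
move=> /(_ _)/le_trans; apply.
  move=> h' h'H; rewrite -(card_setD2 hH h'H) -card_pairs.
  have h'nh : h' != h by move: h'H; rewrite in_setD1 => /andP[].
  rewrite /c; case: ifPn => h'W.
    (* The partner may itself belong to [F], so this exposure can use up two elements of [F] without
       reaching a new vertex; hence the square of [lam]. *)
    set F' := F :\ h :\ h'.
    have sF' : F' \subset F :\ h by apply: subsetDl.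
    have cF' : (#|F'| <= #|F :\ h|)%N by apply: subset_leq_card.
    have := IHk (H :\ h :\ h') F' W.
    have -> : (#|F'| < k)%N by rewrite (leq_ltn_trans cF') // -ltnS -cF.
    move=> /(_ isT _ _ _)/= IH.
    have {IH}IH : \sum_(s in pairs (H :\ h :\ h')) lam ^+ (#|F'| - #|landing s F' :\: W|)
        <= X * #|pairs (H :\ h :\ h')|%:R.
      apply: le_trans (IH _ _ _) _.
      - by rewrite !setSD.
      - by move=> x; rewrite !in_setD1 => /and3P[_ _ /FW].
      - have cF'R : #|F'|%:R <= #|F :\ h|%:R :> R by rewrite ler_nat.
        rewrite cH2 //; apply: le_trans (_ : (#|W| + #|F|)%:R * d%:R <= _).
          by rewrite ler_wpM2r // ler_nat leq_add2l cF ltnW.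
        by apply: le_trans hyp _; apply: ler_wpM2l => //; rewrite cF1; lra.
      by rewrite ler_wpM2r // ler_weXn2l.
    rewrite -mulrA; apply: le_trans (ler_wpM2l (exprn_ge0 2 lam0) IH).
    rewrite mulr_sumr; apply: ler_sum => s _; rewrite -exprD ler_weXn2l //.
    have : (#|landing s F' :\: W| <= #|landing (join h h' s) F :\: W|)%N.
      apply: subset_leq_card; apply: setSD; apply: landing_join_sub.
      - exact: subset_trans sF' (subsetDl _ _).
      - by rewrite !in_setD1 eqxx andbF.
      - by rewrite in_setD1 eqxx.
    have := leq_card_setD2 F h h'; rewrite -/F'.
    exact: leq_sub_add2.
  (* The vertices of [F] all lie in [W], so a partner on a new vertex is outside [F]: [F] loses only
     [h], which the new vertex offsets, and no factor is paid. *)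
  have h'F : h' \notin F by apply: contra h'W; apply: FW.
  set W' := vert h' |: W.
  have cW' : #|W'| = #|W|.+1 by rewrite cardsU1 h'W.
  have := IHk (H :\ h :\ h') (F :\ h) W'.
  rewrite -ltnS -cF ltnS Fk => /(_ isT _ _ _)/= IH.
  have {}IH : \sum_(s in pairs (H :\ h :\ h'))
          lam ^+ (#|F :\ h| - #|landing s (F :\ h) :\: W'|)
        <= X * #|pairs (H :\ h :\ h')|%:R.
    apply: IH.
    - apply/subsetP => x; rewrite !in_setD1 => /andP[xh xF].
      by rewrite xh (subsetP FH) // !andbT; apply: contraNneq h'F => <-.
    - by move=> x; rewrite in_setD1 => /andP[_ /FW xW]; rewrite in_setU1 xW orbT.
    (* The hypothesis on [rho] is shaped for this step: [#|W| + #|F|] and [#|H| - 2 #|F|] are both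
       unchanged. *)
    - rewrite cH2 // cW' addSnnS -cF; apply: le_trans hyp _.
      by apply: ler_wpM2l => //; rewrite cF1; lra.
  rewrite mul1r; apply: le_trans IH; apply: ler_sum => s _.
  rewrite ler_weXn2l // cF.
  have : (#|landing s (F :\ h) :\: W'| < #|landing (join h h' s) F :\: W|)%N.
    apply: (@leq_trans #|vert h' |: (landing s (F :\ h) :\: W')|).
      by rewrite cardsU1 !inE eqxx.
    apply: subset_leq_card; apply/subUsetP; split.
      rewrite sub1set in_setD h'W; apply/imsetP; exists h => //.
      by rewrite ffunE eqxx.
    apply/subsetP => v; rewrite !in_setD in_setU1 negb_or => /andP[/andP[_ ->]] /=.
    apply/subsetP/landing_join_sub; first exact: subsetDl.
    - by rewrite in_setD1 eqxx.
    - by rewrite in_setD1 (negbTE h'F) andbF.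
  by move=> lt_land; rewrite -[leqRHS]subSS leq_sub2l.
rewrite mulrAC; apply: ler_wpM2r; first by [].
have -> : (1 + lam ^+ 2 * rho) ^+ #|F| = X * (1 + lam ^+ 2 * rho).
  by rewrite cF [LHS]exprSr.
rewrite /c -mulr_suml -mulrA [leRHS]mulrC; apply: ler_wpM2r => //.
have Wd : #|W|%:R * d%:R <= rho * (#|H| - 1)%:R :> R.
  apply: le_trans (_ : (#|W| + #|F|)%:R * d%:R <= _).
    by rewrite ler_wpM2r // ler_nat leq_addr.
  apply: le_trans hyp _; apply: ler_wpM2l => //.
  rewrite natrB ?(ltnW H2) // lerB // cF1.
  by have := ler0n R #|F :\ h|; lra.
have sumle : \sum_(h' in H :\ h) (if vert h' \in W then lam ^+ 2 else 1) <=
    (#|H| - 1)%:R + lam ^+ 2 * (#|W| * d)%:R.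
  apply: (@le_trans _ _ (\sum_(h' in H :\ h) (1 + (if vert h' \in W then lam ^+ 2 else 0)))).
    apply: ler_sum => h' _; case: ifP => _; last by rewrite addr0.
    by rewrite lerDr.
  rewrite big_split /= sumr_const (_ : #|H :\ h| = #|H| - 1)%N; last first.
    by rewrite (cardsD1 h H) hH addKn.
  rewrite lerD2l -big_mkcondr /= sumr_const -[leLHS]mulr_natr ler_wpM2l ?exprn_ge0 //.
  rewrite ler_nat; apply: leq_trans (card_preim_le (H :\ h) W).
  by apply: eq_leq; apply: eq_card => x; rewrite inE.
apply: le_trans sumle _; rewrite mulrDl mul1r lerD2l -[leRHS]mulrA.
by apply: ler_wpM2l; rewrite ?exprn_ge0 // natrM.
Qed.

End Repeats.
End Pairings.

(** * Typical pairings *)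

Lemma union_bound (R : numDomainType) (I T : finType) (P : pred T) (E : I -> pred T) :
  (\sum_(s | P s && [exists x, E x s]) 1 <= \sum_x \sum_(s | P s && E x s) 1 :> R)%R.
Proof.
under [leRHS]eq_bigr do rewrite big_mkcondr.
rewrite exchange_big big_mkcondr /=; apply: ler_sum => s _.
case: ifP => [/existsP[x Ex]|_]; last by apply: sumr_ge0 => x _; case: ifP.
by rewrite (bigD1 x) //= Ex lerDl sumr_ge0 // => y _; case: ifP.
Qed.

Section Model.
Variables n d d0 : nat.
Local Notation he := (half_edge n d).
Implicit Types (s : {ffun he -> he}) (S A B X Y : {set 'I_n}) (v : 'I_n).

Lemma pairings_pairs : pairings n d = pairs [set: he].
Proof.
apply/setP => s; rewrite !inE; apply: eq_forallb => h.
by rewrite inE eqb_id andbC.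
Qed.

Lemma card_pairings_gt0 : ~~ odd (n * d) -> 0 < #|pairings n d|.
Proof.
by move=> ev; rewrite pairings_pairs card_pairs cardsT card_prod !card_ord npairs_gt0.
Qed.

Lemma pairing_graph_sym s : s \in pairings n d -> symmetric (pairing_graph s).
Proof.
rewrite pairings_pairs => /pairsP[ss _].
have half u v : pairing_graph s u v -> pairing_graph s v u.
  move=> /existsP[i /existsP[j /eqP E]].
  by apply/existsP; exists j; apply/existsP; exists i; rewrite -E ss.
by move=> u v; apply/idP/idP; apply: half.
Qed.

Lemma pairing_graphP s v i : pairing_graph s v (s (v, i)).1.
Proof.
by apply/existsP; exists i; apply/existsP; exists (s (v, i)).2; rewrite -surjective_pairing.
Qed.

Definition over X : {set he} := [set h : he | h.1 \in X].

(** The union bounds need [d0] small against a power of [n], while [d] may be arbitrarily large;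
    hence the truncation. *)
Definition outs X : {set he} := [set h : he | (h.1 \in X) && (h.2 < d0)].

Definition hits s v B : nat := #|[set i : 'I_d | (i < d0) && ((s (v, i)).1 \in B)]|.

Lemma card_over X : #|over X| = #|X| * d.
Proof.
transitivity #|setX X [set: 'I_d]|; last by rewrite cardsX cardsT card_ord.
apply: eq_card => h.
by rewrite !inE andbT.
Qed.

Lemma card_small_ord : d0 <= d -> #|[set i : 'I_d | i < d0]| = d0.
Proof.
move=> le; transitivity #|[set widen_ord le i | i in 'I_d0]|; last first.
  by rewrite card_imset ?card_ord // => i j /(congr1 val) E; apply: val_inj.
apply: eq_card => i; rewrite inE; apply/idP/imsetP => [id0|[j _ ->]].
  by exists (Ordinal id0) => //; apply: val_inj.
exact: (ltn_ord j).
Qed.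

Lemma card_outs X : d0 <= d -> #|outs X| = #|X| * d0.
Proof.
move=> le; transitivity #|setX X [set i : 'I_d | i < d0]|; last by rewrite cardsX card_small_ord.
apply: eq_card => h.
by rewrite !inE.
Qed.

Lemma outs_over X : outs X \subset over X.
Proof. by apply/subsetP => h; rewrite !inE => /andP[]. Qed.

Variables g H m : nat.

Definition low s S : {set 'I_n} := [set v in S | g * hits s v (S :\ v) < d0].

(** What a failure of threefold expansion leaves behind: the larger set is the smaller one with its
    neighbours in S. Stated in this way the event does not mention S, so it can be excluded for all
    demands at once. *)
Definition dense_pair s : bool :=
  [exists AB : {set 'I_n} * {set 'I_n},
    [&& AB.1 != set0, AB.1 \subset AB.2, #|AB.2| <= 4 * #|AB.1|, #|AB.1| <= m &
        [forall v in AB.1, d0 <= g * hits s v AB.2]]].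

Definition distant_pair s : bool :=
  [exists XY : {set 'I_n} * {set 'I_n},
    [&& [disjoint XY.1 & XY.2], m <= #|XY.1|, m <= #|XY.2| &
        [forall u in XY.1, [forall v in XY.2, ~~ pairing_graph s u v]]]].

(* The first d0 half-edges of the vertices of W lead to |W| d0 - repeats
   vertices outside W. *)
Definition repeats s W : nat := #|outs W| - #|landing fst s (outs W) :\: W|.

Definition overlapping_pair s : bool :=
  [exists vv : 'I_n * 'I_n,
    (vv.1 != vv.2) && (d0 <= H * repeats s [set vv.1; vv.2])].

Definition typical s : bool :=
  [&& ~~ dense_pair s, ~~ distant_pair s & ~~ overlapping_pair s].

Lemma missed_le_typical s S f : s \in pairings n d -> typical s ->
  0 < m -> 6 * m <= #|S| -> optimal (pairing_graph s) S f ->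
  #|missed S f| <=
    (#|isolated (pairing_graph s) S| + 2 * #|clustered (pairing_graph s) (low s S)|).+1.
Proof.
move=> sP /and3P[dense distant _] m0 mS.
apply: (missed_le (pairing_graph_sym sP) _ m0 mS).
- by apply/subsetP => v; rewrite inE => /andP[].
- move=> A AS A0 Am; rewrite leqNgt; apply/negP => lt.
  move/existsPn/(_ (A, A :|: nbrs (pairing_graph s) S A))/negP: dense; apply.
  rewrite /= A0 subsetUl Am /=; apply/andP; split.
    by rewrite (leq_trans (leq_card_setU _ _).1) // [4 * _]mulSn leq_add2l ltnW.
  apply/forall_inP => v vA; have := subsetP AS _ vA.
  rewrite in_setD inE => /andP[+ vS]; rewrite vS /= -leqNgt => /leq_trans; apply.
  rewrite leq_mul2l; apply/orP; right; apply/subset_leq_card/subsetP => i.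
  rewrite !inE => /andP[-> /andP[_ uS]] /=; rewrite uS andbT.
  rewrite -implyNb; apply/implyP => ->.
  by apply/exists_inP; exists v => //; apply: pairing_graphP.
- move=> X Y XY mX mY.
  have : [exists u in X, [exists v in Y, pairing_graph s u v]].
    apply: contraR distant => /exists_inPn no; apply/existsP; exists (X, Y).
    rewrite /= XY mX mY; apply/forall_inP => u /no.
    by move=> /exists_inPn nov; apply/forall_inP.
  by move=> /exists_inP[x xX /exists_inP[y yY xy]]; exists x, y.
Qed.

Section Bounds.
Local Open Scope ring_scope.
Variable R : realType.
Hypotheses (led : (d0 <= d)%N) (d0_gt0 : (0 < d0)%N).

Lemma ratio_over X : #|over X|%:R / #|[set: he]|%:R = #|X|%:R / n%:R :> R.
Proof.
rewrite card_over cardsT card_prod !card_ord !natrM -mulf_div divff ?mulr1 //.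
by rewrite pnatr_eq0 -lt0n (leq_trans d0_gt0).
Qed.

(** On this event some set of at least [#|A| * (d0 %/ g)] exposed half-edges of [A] has all its
    partners over [B]. The power of two counts the candidate sets, and [sum_pairs_stay] bounds
    each. *)
Lemma sum_hits_le A B e : A \subset B -> (0 < g)%N -> (2 * e <= #|A| * (d0 %/ g))%N ->
  \sum_(s in pairings n d | [forall v in A, d0 <= g * hits s v B]%N) 1 <=
    2 ^+ (#|A| * d0) * (#|B|%:R / n%:R) ^+ e * #|pairings n d|%:R :> R.
Proof.
move=> AB g0 eA; rewrite pairings_pairs.
pose E (F : {set he}) (s : {ffun he -> he}) := [&& F \subset outs A,
  (2 * e <= #|F|)%N & [forall x in F, s x \in over B]].
have imp s : [forall v in A, d0 <= g * hits s v B]%N -> [exists F, E F s].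
  move=> /forall_inP hitsA; apply/existsP.
  exists [set h in outs A | s h \in over B]; apply/and3P; split.
  - by apply/subsetP => h; rewrite inE => /andP[].
  - apply: leq_trans eA _.
    rewrite -[leqRHS]sum1_card (partition_big fst (mem A)) /=; last first.
      by move=> h; rewrite !inE => /andP[/andP[]].
    rewrite -sum_nat_const; apply: leq_sum => v vA.
    rewrite sum1_card.
    apply: (@leq_trans (hits s v B)); last first.
      rewrite /hits -(@card_imset _ _ (fun i : 'I_d => (v, i) : he)); last by move=> i j [].
      apply/subset_leq_card/subsetP => _ /imsetP[i + ->].
      by rewrite inE => /andP[id0 sB]; rewrite unfold_in !inE /= vA id0 sB eqxx.
    by rewrite (leq_trans (leq_div2r g (hitsA v vA))) // mulKn.
  - by apply/forall_inP => h; rewrite inE => /andP[].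
apply: (@le_trans _ _ (\sum_(s in pairs [set: he] | [exists F, E F s]) 1)).
  rewrite big_mkcondr [leRHS]big_mkcondr /=; apply: ler_sum => s _.
  by case: ifP => [/imp ->|_] //; case: ifP.
apply: le_trans (union_bound _ _ _) _.
rewrite (bigID (fun F : {set he} => F \subset outs A)) /= [X in _ + X]big1 ?addr0; last first.
  by move=> F FA; rewrite big_pred0 // => s; rewrite /E (negbTE FA) andbF.
apply: (@le_trans _ _ (\sum_(F in powerset (outs A))
    (#|B|%:R / n%:R) ^+ e * #|pairs [set: he]|%:R)).
  rewrite [leRHS](eq_bigl (fun F : {set he} => F \subset outs A)) => [|F]; last by rewrite inE.
  apply: ler_sum => F FA; have [eF|eF] := boolP (2 * e <= #|F|)%N; last first.
    rewrite big_pred0 => [|s]; last by rewrite /E (negbTE eF) andbF andbF.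
    by rewrite mulr_ge0 ?exprn_ge0 ?divr_ge0.
  rewrite -ratio_over; apply: le_trans (sum_pairs_stay _ _ _ eF).
  - by rewrite [leLHS]big_mkcondr [leRHS]big_mkcondr /=; apply: ler_sum => s _; rewrite /E FA eF.
  - apply: subset_trans FA _; apply: subset_trans (outs_over A) _.
    by apply/subsetP => h; rewrite !inE; apply: (subsetP AB).
  - exact: subsetT.
by rewrite sumr_const card_powerset card_outs // -[leLHS]mulr_natl natrX mulrA.
Qed.

End Bounds.
End Model.

Lemma level_arith1 q kap k :
  q < kap.+1 * 2 -> kap < k.+1 * 4 -> 2 <= k -> q.+1 <= 16 * k.
Proof. by lia. Qed.

Lemma level_arith2 kap k : k * 4 <= kap -> 2 <= k -> k + k <= kap - 4.
Proof. by lia. Qed.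

(** * Small sets expand *)

Section DensePairs.
Local Open Scope ring_scope.
Variable R : realType.

Lemma sum_sets_exp (T : finType) (x : R) :
  \sum_(B : {set T}) x ^+ #|B| = (1 + x) ^+ #|T|.
Proof.
rewrite -[RHS]prodr_const addrC bigA_distr /=; apply: eq_bigr => B _.
by rewrite -big_mkcond prodr_const.
Qed.

(** Every counted set has [x ^+ #|B| >= x ^+ b]. With [x = b / #|T|] this yields the usual bound
    [(e #|T| / b)^b]. *)
Lemma card_small_sets (T : finType) (x : R) b : 0 < x -> x <= 1 ->
  #|[set B : {set T} | (#|B| <= b)%N]|%:R <= (1 + x) ^+ #|T| / x ^+ b.
Proof.
move=> x0 x1; rewrite ler_pdivlMr ?exprn_gt0 // -sum_sets_exp mulr_natl.
rewrite -sumr_const [leRHS](bigID (mem [set B : {set T} | (#|B| <= b)%N])) /=.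
apply: ler_wpDr; first by apply: sumr_ge0 => B _; rewrite exprn_ge0 // ltW.
by apply: ler_sum => B; rewrite inE => le_b; rewrite ler_wiXn2l // ltW.
Qed.

Lemma card_nested_sets (T : finType) b :
  (#|[set AB : {set T} * {set T} | (AB.1 \subset AB.2) && (#|AB.2| <= b)]| <=
    2 ^ b * #|[set B : {set T} | #|B| <= b]|)%N.
Proof.
rewrite -sum1_card (partition_big snd (mem [set B : {set T} | #|B| <= b]%N)) /=; last first.
  by move=> AB; rewrite !inE => /andP[].
rewrite mulnC -sum_nat_const; apply: leq_sum => B; rewrite inE => le_b.
rewrite sum1dep_card; apply: (@leq_trans #|powerset B|); last first.
  by rewrite card_powerset leq_exp2l.
rewrite -(@card_imset _ _ (fun A : {set T} => (A, B))); last by move=> A A' [].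
apply/subset_leq_card/subsetP => -[A B']; rewrite !inE /=.
by move=> /andP[/andP[AB _] /eqP E]; apply/imsetP; exists A; rewrite ?inE -E.
Qed.

Variables n d d0 g : nat.
Hypotheses (led : (d0 <= d)%N) (d0_gt0 : (0 < d0)%N) (g0 : (0 < g)%N).
Local Notation he := (half_edge n d).
Let kap := (d0 %/ g %/ 2)%N.
Let C0 : R := 16 * expR 4.

Let C0_ge0 : 0 <= C0.
Proof. by rewrite mulr_ge0 ?expR_ge0. Qed.

(** There are at most [2^(4a) (e / x)^(4a)] nested pairs: the constants form [C0 ^+ a], and
    [x^(-4a)] lowers the exponent [kap], the number of exposures per vertex, by four. *)
Lemma sum_dense_level a (x := 4 * a%:R / n%:R : R) :
  (0 < a)%N -> (0 < n)%N -> x <= 1 -> (4 <= kap)%N ->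
  \sum_(s in pairings n d |
      [exists AB : {set 'I_n} * {set 'I_n},
        [&& #|AB.1| == a, AB.1 \subset AB.2, #|AB.2| <= 4 * a &
            [forall v in AB.1, d0 <= g * hits d0 s v AB.2]]%N]) 1 <=
    (C0 * 2 ^+ d0 * x ^+ (kap - 4)) ^+ a * #|pairings n d|%:R.
Proof.
move=> a0 n0 x1 kap4.
have x0 : 0 < x by rewrite divr_gt0 ?ltr0n // mulr_gt0 // ltr0n.
apply: le_trans (union_bound _ _ _) _.
pose b : R := 2 ^+ (a * d0) * x ^+ (a * kap) * #|pairings n d|%:R.
have b0 : 0 <= b by rewrite !mulr_ge0 ?exprn_ge0 // ltW.
pose P := [set AB : {set 'I_n} * {set 'I_n} | (AB.1 \subset AB.2) && (#|AB.2| <= 4 * a)%N].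
rewrite (bigID (mem P)) /= [X in _ + X]big1 ?addr0; last first.
  move=> AB; rewrite inE => ABP; rewrite big_pred0 // => s; apply/negbTE.
  by apply: contra ABP => /andP[_ /and4P[_ -> ->]].
apply: (@le_trans _ _ (\sum_(AB in P) b)).
  apply: ler_sum => -[A B]; rewrite inE /= => /andP[AB Ba].
  have [/eqP cA|cA] := boolP (#|A| == a); last by rewrite big_pred0 // => s; rewrite andbF.
  rewrite AB Ba /=; apply: le_trans (_ :
    2 ^+ (#|A| * d0) * (#|B|%:R / n%:R) ^+ (a * kap) * #|pairings n d|%:R <= _).
    by apply: sum_hits_le; rewrite // cA mulnCA leq_mul2l mulnC leq_trunc_div orbT.
  rewrite cA ler_wpM2r // ler_wpM2l ?exprn_ge0 //.
  apply: lerXn2r; rewrite ?nnegrE; [by rewrite divr_ge0 | exact: ltW |].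
  by rewrite /x ler_wpM2r ?invr_ge0 // -natrM ler_nat.
rewrite sumr_const -[leLHS]mulr_natl /b mulrA ler_wpM2r //.
have cP : #|P|%:R <= 2 ^+ (4 * a) * (expR 4 ^+ a / x ^+ (4 * a)).
  apply: (@le_trans _ _ (2 ^+ (4 * a) * #|[set B : {set 'I_n} | (#|B| <= 4 * a)%N]|%:R)).
    by rewrite -natrX -natrM ler_nat card_nested_sets.
  rewrite ler_wpM2l ?exprn_ge0 //; apply: le_trans (card_small_sets _ _ x0 x1) _.
  rewrite ler_wpM2r ?invr_ge0 ?exprn_ge0 ?(ltW x0) // card_ord.
  apply: (@le_trans _ _ (expR x ^+ n)).
    by apply: lerXn2r; rewrite ?nnegrE ?expR_ge0 ?expR_ge1Dx // addr_ge0 // (ltW x0).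
  rewrite -!expRM_natl ler_expR [leLHS]mulrC /x divfK ?pnatr_eq0 -?lt0n //.
  by rewrite mulrC.
apply: le_trans (ler_wpM2r _ cP) _; first by rewrite mulr_ge0 ?exprn_ge0 // ltW.
have -> : x ^+ (a * kap) = x ^+ (4 * a) * (x ^+ (kap - 4)) ^+ a.
  by rewrite -exprM -exprD; congr (_ ^+ _); rewrite -{1}(subnKC kap4); lia.
have x4 : x ^+ (4 * a) != 0 by rewrite expf_neq0 // gt_eqF.
clear b b0 cP; clearbody x; rewrite /C0 !exprMn -!exprM [(d0 * a)%N]mulnC.
have -> : 16 ^+ a = 2 ^+ (4 * a) :> R by rewrite exprM; congr (_ ^+ _); lra.
rewrite le_eqVlt; apply/orP; left; apply/eqP.
move: (2 ^+ (4 * a)) (expR 4 ^+ a) (x ^+ (4 * a)) (2 ^+ (a * d0)) (x ^+ _) x4 => u v w y z w0.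
by field.
Qed.

(** One factor is kept and the [a - 1] others are at most one half; [2^(a - 1) >= a] absorbs the
    numerator. Each size of set thus costs no more than singletons. *)
Lemma pow_frac_le a : (0 < a)%N -> 4 * a%:R / n%:R <= 2^-1 :> R ->
  (4 * a%:R / n%:R) ^+ a <= 4 / n%:R :> R.
Proof.
case: a => // a _ x1; rewrite exprS; set x := 4 * a.+1%:R / n%:R in x1 *.
have x0 : 0 <= x by rewrite divr_ge0 // mulr_ge0.
apply: (@le_trans _ _ (x * (2^-1) ^+ a)).
  by rewrite ler_wpM2l // lerXn2r // nnegrE invr_ge0.
rewrite exprVn ler_pdivrMr ?exprn_gt0 // /x mulrAC.
apply: ler_wpM2l; first by rewrite divr_ge0.
by rewrite -natrX ler_nat ltn_expl.
Qed.

(** Half of the exponent pays for the constants: [kap - 4 >= 2 k] and [d0 <= 16 g k], so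
    [C0 * 2 ^+ d0] is at most [(C0 * 2 ^+ (16 * g)) ^+ k], which one factor [x ^+ k] cancels. *)
Lemma level_base_le (x : R) (k := (kap %/ 4)%N) : 0 < x ->
  C0 * 2 ^+ (16 * g) * x <= 1 -> (2 <= k)%N ->
  C0 * 2 ^+ d0 * x ^+ (kap - 4) <= x ^+ k.
Proof.
move=> x0 Cx k2.
have C1 : 1 <= C0.
  have : 1 <= expR 4 :> R by rewrite -[leLHS]expR0 ler_expR.
  by rewrite /C0; move: (expR 4) => y; lra.
have g16 : 1 <= 2 ^+ (16 * g) :> R by rewrite exprn_ege1 // ler1n.
have Cx0 : 0 <= C0 * 2 ^+ (16 * g) by rewrite mulr_ge0 ?(le_trans ler01).
have x1 : x <= 1.
  apply: le_trans Cx; rewrite -[leLHS]mul1r ler_wpM2r ?(ltW x0) //.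
  by rewrite -[leLHS]mul1r ler_pM.
have d0k : (d0 <= 16 * g * k)%N.
  have h1 := ltn_ceil d0 g0; have h2 := ltn_ceil (d0 %/ g) (isT : (0 < 2)%N).
  have h3 := ltn_ceil kap (isT : (0 < 4)%N).
  move: h1 h2 h3; rewrite -/kap -/k; move: (d0 %/ g)%N => q h1 h2 h3.
  have q8 : (q.+1 <= 16 * k)%N by exact: level_arith1 h2 h3 k2.
  apply: ltnW; apply: leq_trans h1 _.
  by rewrite [(16 * g)%N]mulnC -mulnA mulnC leq_mul2l q8 orbT.
have kk : (k + k <= kap - 4)%N by exact: level_arith2 (leq_trunc_div kap 4) k2.
apply: (@le_trans _ _ (C0 ^+ k * (2 ^+ (16 * g)) ^+ k * (x ^+ k * x ^+ k))).
  apply: ler_pM.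
  - by rewrite mulr_ge0 ?exprn_ge0 // (le_trans ler01).
  - by rewrite exprn_ge0 // ltW.
  - apply: ler_pM; [exact: le_trans C1 | by rewrite exprn_ge0 | |].
      by apply: ler_eXnr => //; apply: leq_trans k2.
    by rewrite -exprM ler_weXn2l // ler1n.
  - by rewrite -exprD; apply: ler_wiXn2l => //; exact: ltW.
rewrite mulrA -!exprMn; apply: lerXn2r; rewrite ?nnegrE ?(ltW x0) //.
  by apply: mulr_ge0 (ltW x0); apply: mulr_ge0 Cx0 (ltW x0).
by rewrite -[leRHS]mul1r; apply: ler_wpM2r => //; apply: ltW.
Qed.

Lemma sum_dense_pair M (k := (kap %/ 4)%N) : (0 < n)%N -> (0 < M)%N ->
  4 * (C0 * 2 ^+ (16 * g)) <= M%:R -> (2 <= k)%N ->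
  \sum_(s in pairings n d | dense_pair d0 g (n %/ M) s) 1 <=
    n%:R * (4 / n%:R) ^+ k * #|pairings n d|%:R :> R.
Proof.
move=> n0 M0 CM k2; set m := (n %/ M)%N.
have nR : 0 < n%:R :> R by rewrite ltr0n.
have MR : 0 < M%:R :> R by rewrite ltr0n.
pose E (i : 'I_m) (s : {ffun he -> he}) := [exists AB : {set 'I_n} * {set 'I_n},
        [&& #|AB.1| == i.+1, AB.1 \subset AB.2, #|AB.2| <= 4 * i.+1 &
            [forall v in AB.1, d0 <= g * hits d0 s v AB.2]]%N].
apply: (@le_trans _ _ (\sum_(s in pairings n d | [exists i, E i s]) 1)).
  rewrite big_mkcondr [leRHS]big_mkcondr /=; apply: ler_sum => s _.
  case: ifP => [/existsP[[A B] /= /and5P[A0 AB BA Am hA]]|_]; last by case: ifP.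
  have A1 : (#|A|.-1.+1 = #|A|)%N by rewrite prednK // card_gt0.
  case: ifPn => // /negP[]; apply/existsP.
  have Am' : (#|A|.-1 < m)%N by rewrite A1.
  by exists (Ordinal Am'); apply/existsP; exists (A, B); rewrite /= A1 eqxx AB BA hA.
apply: le_trans (union_bound _ _ _) _.
apply: (@le_trans _ _ (\sum_(i < m) (4 / n%:R) ^+ k * #|pairings n d|%:R)).
  apply: ler_sum => i _; set x : R := 4 * i.+1%:R / n%:R.
  have x0 : 0 < x by rewrite divr_gt0 // mulr_gt0.
  have xM : x <= 4 / M%:R.
    rewrite /x -mulrA ler_wpM2l // ler_pdivrMr // mulrC ler_pdivlMr //.
    rewrite -natrM ler_nat; apply: leq_trans (leq_trunc_div n M).
    by rewrite leq_mul2r ltn_ord orbT.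
  have Cx : C0 * 2 ^+ (16 * g) * x <= 1.
    apply: le_trans (_ : C0 * 2 ^+ (16 * g) * (4 / M%:R) <= _).
      by rewrite ler_wpM2l // mulr_ge0 ?exprn_ge0 // mulr_ge0 // expR_ge0.
    by rewrite mulrA ler_pdivrMr // mul1r mulrC.
  have x2 : x <= 2^-1.
    have C2 : 2 <= C0 * 2 ^+ (16 * g).
      have : 1 <= expR 4 :> R by rewrite -[leLHS]expR0 ler_expR.
      have : 1 <= 2 ^+ (16 * g) :> R by rewrite exprn_ege1 // ler1n.
      rewrite /C0; move: (expR 4) (2 ^+ _) => y z z1 y1; nra.
    rewrite -[leRHS]mulr1 ler_pdivlMl //; apply: le_trans Cx.
    by rewrite ler_wpM2r // ltW.
  apply: le_trans (sum_dense_level _ n0 _ _) _ => //.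
  - by rewrite (le_trans x2) // invf_le1 // ler1n.
  - by rewrite (leq_trans _ (leq_trunc_div kap 4)) // (leq_pmull 4) // (leq_trans _ k2).
  rewrite ler_wpM2r // -/x.
  apply: (@le_trans _ _ ((x ^+ k) ^+ i.+1)).
    apply: lerXn2r; rewrite ?nnegrE ?exprn_ge0 ?(ltW x0) //.
      by do 2?apply: mulr_ge0; rewrite ?exprn_ge0 ?(ltW x0).
    exact: level_base_le.
  rewrite exprAC; apply: lerXn2r; rewrite ?nnegrE.
  - by rewrite exprn_ge0 ?(ltW x0).
  - by rewrite divr_ge0.
  exact: pow_frac_le.
rewrite sumr_const card_ord -[leLHS]mulr_natl mulrA ler_wpM2r //.
by rewrite ler_wpM2r ?exprn_ge0 ?divr_ge0 // ler_nat leq_div.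
Qed.

End DensePairs.

(** * Large sets are joined, and exposures overlap little *)

Section DistantAndOverlapping.
Local Open Scope ring_scope.
Variables (R : realType) (n d d0 : nat).
Hypotheses (led : (d0 <= d)%N) (d0_gt0 : (0 < d0)%N).
Local Notation he := (half_edge n d).

(** All exposed half-edges of one set must avoid the other, whose density is at least [1 / (2M)],
    the 2 covering the rounding of [n %/ M]. The base [8^-1] leaves [2^-n] after the [4^n] choices
    of the pair. *)
Lemma sum_distant_pair M j : (0 < M)%N -> (M <= n)%N ->
  (1 - (2 * M%:R)^-1) ^+ j <= 8^-1 :> R -> (2 * M * j <= d0 %/ 2)%N ->
  \sum_(s in pairings n d | distant_pair (n %/ M) s) 1 <=
    (2^-1) ^+ n * #|pairings n d|%:R :> R.
Proof.
move=> M0 Mn; set b : R := 1 - _ => bj jd; set m := (n %/ M)%N.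
have m0 : (0 < m)%N by rewrite divn_gt0.
have n0 : (0 < n)%N by apply: leq_trans M0 Mn.
have MR : 0 < 2 * M%:R :> R by rewrite mulr_gt0 // ltr0n.
have nR : 0 < n%:R :> R by rewrite ltr0n.
have nm : (n <= m * (2 * M))%N.
  rewrite mulnCA mul2n -addnn; apply: leq_trans (ltnW (ltn_ceil n M0)) _.
  by rewrite mulSn leq_add2r leq_pmull.
have b0 : 0 <= b.
  by rewrite subr_ge0 invf_le1 // -natrM ler1n muln_gt0.
have b1 : b <= 1 by rewrite gerBl invr_ge0 ltW.
pose e := (m * (d0 %/ 2))%N.
have be : b ^+ e <= (8^-1) ^+ n.
  apply: (@le_trans _ _ ((b ^+ j) ^+ n)); last first.
    by apply: lerXn2r; rewrite ?nnegrE ?exprn_ge0 ?invr_ge0.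
  rewrite -exprM; apply: ler_wiXn2l => //.
  rewrite mulnC; apply: leq_trans (_ : m * (2 * M * j) <= _)%N.
    by rewrite mulnA leq_mul2r nm orbT.
  by rewrite leq_mul2l jd orbT.
pose E (XY : {set 'I_n} * {set 'I_n}) (s : {ffun he -> he}) :=
  [&& [disjoint XY.1 & XY.2], (m <= #|XY.1|)%N, (m <= #|XY.2|)%N &
      [forall u in XY.1, [forall v in XY.2, ~~ pairing_graph s u v]]].
apply: le_trans (union_bound _ _ E) _.
apply: (@le_trans _ _ (\sum_(XY : {set 'I_n} * {set 'I_n}) (8^-1) ^+ n * #|pairings n d|%:R)).
  apply: ler_sum => -[X Y] _; rewrite /E /=.
  have [/and3P[XY mX mY]|no] :=
    boolP [&& [disjoint X & Y], (m <= #|X|)%N & (m <= #|Y|)%N]; last first.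
    rewrite big_pred0 ?mulr_ge0 ?exprn_ge0 ?invr_ge0 // => s.
    by apply/negbTE; apply: contra no => /andP[_ /and4P[-> -> ->]].
  rewrite XY mX mY /=.
  apply: (@le_trans _ _ ((#|~: Y|%:R / n%:R) ^+ e * #|pairings n d|%:R)); last first.
    rewrite ler_wpM2r //; apply: le_trans be; apply: lerXn2r; rewrite ?nnegrE ?divr_ge0 //.
    have cY : #|~: Y|%:R = n%:R - #|Y|%:R :> R.
      rewrite cardsCs setCK card_ord natrB //.
      by rewrite -[leqRHS]card_ord max_card.
    rewrite ler_pdivrMr // /b mulrBl mul1r cY lerB // ler_pdivrMl //.
    rewrite -natrM -natrM ler_nat mulnC.
    by apply: leq_trans nm _; rewrite leq_mul2r mY orbT.
  rewrite -(ratio_over R led d0_gt0) pairings_pairs.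
  apply: le_trans (sum_pairs_stay _ (F := outs d d0 X) _ _ _).
  - rewrite [leLHS]big_mkcondr [leRHS]big_mkcondr /=; apply: ler_sum => s _.
    case: ifP => [/forall_inP noXY|_]; last by case: ifP.
    case: ifPn => // /negP[]; apply/forall_inP => -[u i].
    rewrite !inE /= => /andP[/noXY /forall_inP no _].
    by apply/negP => /no /negP; apply; apply: pairing_graphP.
  - apply: subset_trans (outs_over _ _ X) _; apply/subsetP => h.
    have XsY : X \subset ~: Y by rewrite -disjoints_subset.
    by rewrite [h \in over _ X]inE [h \in over _ _]inE; apply: (subsetP XsY).
  - exact: subsetT.
  - rewrite card_outs // /e mulnCA; apply: leq_mul mX _.
    by rewrite mulnC leq_trunc_div.
rewrite sumr_const card_prod -!cardsT -!powersetT !card_powerset !cardsT !card_ord.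
rewrite -[leLHS]mulr_natl mulrA ler_wpM2r // natrM !natrX -!exprMn.
apply: lerXn2r; rewrite ?nnegrE ?mulr_ge0 ?invr_ge0 //; lra.
Qed.

Let rho : R := 4 * d0.+1%:R / n%:R.

(** Markov's inequality for [sum_pairs_repeat] with [lam = rho^(-1/2)], so that [lam ^+ 2 * rho = 1]
    and the base there becomes two. *)
Lemma sum_repeats (W : {set 'I_n}) r : (8 <= n)%N -> (#|W| <= 2)%N -> rho <= 1 ->
  \sum_(s in pairings n d | (r <= repeats d0 s W)%N) 1 <=
    2 ^+ (#|W| * d0) * Num.sqrt rho ^+ r * #|pairings n d|%:R :> R.
Proof.
move=> n8 W2 rho1.
have nR : 0 < n%:R :> R by rewrite ltr0n (leq_trans _ n8).
have rho0 : 0 < rho by rewrite divr_gt0 // mulr_gt0.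
have sr0 : 0 < Num.sqrt rho by rewrite sqrtr_gt0.
pose lam := (Num.sqrt rho)^-1.
have lam1 : 1 <= lam.
  by rewrite invf_ge1 // -sqrtr1 ler_wsqrtr.
have lam_rho : lam ^+ 2 * rho = 1.
  by rewrite /lam exprVn sqr_sqrtr ?(ltW rho0) // mulVf // gt_eqF.
have outsW : {in outs d d0 W, forall h, h.1 \in W} by move=> h; rewrite inE => /andP[].
have fib v : (#|[set h : he | h.1 == v]| <= d)%N.
  rewrite (_ : [set h : he | h.1 == v] = over d [set v]).
    by rewrite card_over cards1 mul1n.
  by apply/setP => h; rewrite !inE.
have hyp : (#|W| + #|outs d d0 W|)%:R * d%:R <=
    rho * (#|[set: he]|%:R - 2 * #|outs d d0 W|%:R).
  rewrite card_outs // cardsT card_prod !card_ord -mulnS.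
  apply: (@le_trans _ _ (2 * d0.+1%:R * d%:R)).
    by rewrite natrM ler_wpM2r // ler_wpM2r // (ler_nat R _ 2).
  apply: (@le_trans _ _ (rho * ((n%:R - 4) * d%:R))).
    rewrite mulrA ler_wpM2r // /rho mulrAC ler_pdivlMr //.
    have n8R : 8 <= n%:R :> R by rewrite (ler_nat R 8).
    have : 0 <= d0.+1%:R :> R by [].
    move: n%:R d0.+1%:R n8R => x y x8 y0.
    by nra.
  rewrite ler_pM2l // mulrBl natrM lerB // (@le_trans _ _ (2 * (2 * d)%:R)) //.
    rewrite ler_wpM2l // ler_nat; exact: leq_mul.
  by rewrite natrM mulrA; lra.
have := sum_pairs_repeat fib (subsetT (outs d d0 W)) outsW lam1 (ltW rho0) hyp.
rewrite lam_rho card_outs // -pairings_pairs => le.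
have lr : 0 < lam ^+ r by rewrite exprn_gt0 // (lt_le_trans ltr01).
have -> : Num.sqrt rho ^+ r = (lam ^+ r)^-1 by rewrite /lam exprVn invrK.
rewrite mulrAC ler_pdivlMr //; apply: le_trans le; rewrite mulr_suml.
rewrite [leLHS]big_mkcondr /=; apply: ler_sum => s _.
case: ifP => [rs|_]; last by rewrite exprn_ge0 // (le_trans ler01).
by move: rs; rewrite /repeats card_outs // => rs; rewrite mul1r ler_weXn2l.
Qed.

Lemma sum_overlapping_pair H : (0 < H)%N -> (8 <= n)%N -> rho <= 1 ->
  \sum_(s in pairings n d | overlapping_pair d0 H s) 1 <=
    n%:R ^+ 2 * 4 ^+ d0 * rho ^+ (d0 %/ (2 * H)) * #|pairings n d|%:R :> R.
Proof.
move=> H0 n8 rho1; set k := (d0 %/ _)%N.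
have rho0 : 0 <= rho by rewrite divr_ge0 // mulr_ge0.
pose E (vv : 'I_n * 'I_n) (s : {ffun he -> he}) :=
  (vv.1 != vv.2) && (d0 <= H * repeats d0 s [set vv.1; vv.2])%N.
apply: le_trans (union_bound _ _ E) _.
apply: (@le_trans _ _ (\sum_(vv : 'I_n * 'I_n) 4 ^+ d0 * rho ^+ k * #|pairings n d|%:R)).
  apply: ler_sum => -[u v] _; rewrite /E /=.
  have [->|uv] := eqVneq u v.
    rewrite big_pred0 ?mulr_ge0 ?exprn_ge0 // => s; exact: andbF.
  have c2 : #|[set u; v]| = 2 by rewrite cards2 uv.
  have := @sum_repeats [set u; v] (2 * k) n8; rewrite c2 => /(_ isT rho1).
  rewrite [Num.sqrt rho ^+ _]exprM sqr_sqrtr // exprM (_ : 2 ^+ 2 = 4 :> R); last by lra.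
  apply: le_trans; rewrite big_mkcondr [leRHS]big_mkcondr /=; apply: ler_sum => s _.
  case: ifP => [le_d0|_]; last by case: ifP.
  suff -> : (2 * k <= repeats d0 s [set u; v])%N by [].
  rewrite -(leq_pmul2l H0); apply: leq_trans le_d0.
  by rewrite mulnCA mulnA mulnC leq_trunc_div.
by rewrite sumr_const card_prod !card_ord -[leLHS]mulr_natl natrM !mulrA -expr2.
Qed.

End DistantAndOverlapping.

(** * Expectation over the demands *)

Lemma cover_arith1 r c d0 : 2 * d0 <= c + r -> 15 * r < d0 -> 29 * d0 <= 15 * c.
Proof. by lia. Qed.

Lemma cover_arith2 r c d0 : d0 <= c + r -> 15 * r < d0 -> 14 * d0 <= 15 * c.
Proof. by lia. Qed.

Lemma cover_arith3 g x y z d0 :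
  x <= y + z -> 2 * g * y < d0 -> 2 * g * z < d0 -> g * x <= d0.
Proof. by nia. Qed.

Section Expectation.
Local Open Scope ring_scope.
Variables (R : realType) (n : nat) (p : R).
Hypotheses (p0 : 0 < p) (p1 : p < 1).
Local Notation toss := {ffun 'I_n -> bool}.
Implicit Types (w : toss) (f g : toss -> R).

Definition toss_weight w : R := \prod_(j < n) (if w j then p else 1 - p).

Definition Ew f : R := \sum_w toss_weight w * f w.

Lemma toss_weight_ge0 w : 0 <= toss_weight w.
Proof. by apply: prodr_ge0 => j _; case: ifP => _; rewrite ?subr_ge0 ltW. Qed.

Lemma le_Ew f g : (forall w, f w <= g w) -> Ew f <= Ew g.
Proof. by move=> le; apply: ler_sum => w _; rewrite ler_wpM2l ?toss_weight_ge0. Qed.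

Lemma Ew_prod (F : 'I_n -> bool -> R) :
  Ew (fun w => \prod_j F j (w j)) = \prod_j (p * F j true + (1 - p) * F j false).
Proof.
transitivity (\prod_(j < n) \sum_(b : bool) (if b then p else 1 - p) * F j b).
  rewrite bigA_distr_bigA; apply: eq_bigr => w _.
  by rewrite /toss_weight -big_split.
by apply: eq_bigr => j _; rewrite big_bool.
Qed.

Lemma Ew_cst c : Ew (fun=> c) = c.
Proof.
rewrite /Ew -mulr_suml [X in X * _](_ : _ = 1) ?mul1r //.
transitivity (Ew (fun w => \prod_(j < n) 1)).
  by apply: eq_bigr => w _; rewrite big1 ?mulr1.
by rewrite (Ew_prod (fun _ _ => 1)) big1 // => j _; rewrite !mulr1 subrKC.
Qed.

Lemma EwD f g : Ew (fun w => f w + g w) = Ew f + Ew g.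
Proof. by rewrite -big_split; apply: eq_bigr => w _; rewrite mulrDr. Qed.

Lemma EwZ c f : Ew (fun w => c * f w) = c * Ew f.
Proof. by rewrite mulr_sumr; apply: eq_bigr => w _; rewrite mulrCA. Qed.

Lemma Ew_sum (I : finType) (P : pred I) (F : I -> toss -> R) :
  Ew (fun w => \sum_(i | P i) F i w) = \sum_(i | P i) Ew (F i).
Proof. by rewrite exchange_big; apply: eq_bigr => w _; rewrite mulr_sumr. Qed.

Definition supp w : {set 'I_n} := [set j | w j].

Lemma mean_loss_Ew (G : rel 'I_n) : mean_loss p G = Ew (fun w => loss G (demand_of R w)).
Proof. by []. Qed.

Lemma Ew_exp_card (C : {set 'I_n}) t :
  Ew (fun w => t ^+ #|supp w :&: C|) = (1 - p + p * t) ^+ #|C|.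
Proof.
transitivity (Ew (fun w => \prod_j (if (j \in C) && w j then t else 1))).
  apply: eq_bigr => w _; congr (_ * _); rewrite -big_mkcond prodr_const.
  by congr (_ ^+ _); apply: eq_card => j; rewrite !inE andbC.
rewrite (Ew_prod (fun j b => if (j \in C) && b then t else 1)).
rewrite -prodr_const [RHS]big_mkcond; apply: eq_bigr => j _.
by case: (j \in C); rewrite /= !mulr1; [rewrite addrC | rewrite subrKC].
Qed.

Lemma Ew_isolated (G : rel 'I_n) v :
  Ew (fun w => (v \in isolated G (supp w))%:R) =
    p * (1 - p) ^+ #|[set u | (u != v) && G v u]|.
Proof.
pose F u (b : bool) : R := if u == v then b%:R else if G v u then (~~ b)%:R else 1.
transitivity (Ew (fun w => \prod_u F u (w u))).
  apply: eq_bigr => w _; congr (_ * _).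
  have [vI|vI] := boolP (v \in isolated G (supp w)).
    move: vI; rewrite inE => /andP[wv /forall_inP noG]; rewrite inE in wv.
    rewrite big1 // => u _; rewrite /F; case: eqP => [->|/eqP uv]; first by rewrite wv.
    case: ifP => // vu; have [wu|//] := boolP (w u).
    by have := noG u; rewrite inE wu uv vu => /(_ isT).
  apply/esym/eqP/prodf_eq0; move: vI; rewrite inE negb_and => /orP[|].
    by rewrite inE => wv; exists v; rewrite // /F eqxx (negbTE wv).
  move=> /forall_inPn[u]; rewrite inE negb_imply negbK => wu /andP[uv vu].
  by exists u; rewrite // /F (negbTE uv) vu wu.
rewrite Ew_prod (bigD1 v) //= /F eqxx mulr1 mulr0 addr0; congr (_ * _).
rewrite -prodr_const big_mkcond [RHS]big_mkcond /=; apply: eq_bigr => u _.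
rewrite inE; case: eqP => //= _.
by case: (G v u); rewrite ?mulr1 ?mulr0 ?add0r // subrKC.
Qed.

Variables (a t : R) (g : nat).
Hypotheses (a0 : 0 < a) (a1 : a < 1) (t0 : 0 < t).
Hypotheses (at_g : a ^+ g <= t) (qa : 1 - p + p * t <= a ^+ 15).

(* Exponential Markov inequality for a lower tail. *)
Lemma Ew_few (C : {set 'I_n}) (P : pred toss) N :
  (forall w, P w -> (g * #|supp w :&: C| <= N)%N) ->
  Ew (fun w => (P w)%:R) <= a ^+ (15 * #|C|) / a ^+ N.
Proof.
move=> few; rewrite ler_pdivlMr ?exprn_gt0 // mulrC -EwZ.
apply: (@le_trans _ _ (Ew (fun w => t ^+ #|supp w :&: C|))).
  apply: le_Ew => w; case: (boolP (P w)) => [/few le_N|_]; last first.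
    by rewrite mulr0 exprn_ge0 // ltW.
  rewrite mulr1; apply: (@le_trans _ _ (a ^+ (g * #|supp w :&: C|))).
    by apply: ler_wiXn2l => //; apply: ltW.
  by rewrite exprM; apply: lerXn2r; rewrite ?nnegrE ?exprn_ge0 // ltW.
rewrite Ew_exp_card exprM; apply: lerXn2r; rewrite ?nnegrE ?exprn_ge0 ?(ltW a0) //.
by rewrite addr_ge0 ?subr_ge0 ?(ltW p1) // mulr_ge0 // ltW.
Qed.

Lemma Ew_few_le (C : {set 'I_n}) (P : pred toss) N k :
  (forall w, P w -> (g * #|supp w :&: C| <= N)%N) -> (k + N <= 15 * #|C|)%N ->
  Ew (fun w => (P w)%:R) <= a ^+ k.
Proof.
move=> few le_k; apply: le_trans (Ew_few few) _.
rewrite ler_pdivrMr ?exprn_gt0 // -exprD; apply: ler_wiXn2l => //; exact: ltW.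
Qed.

Lemma Ew_small_supp : Ew (fun w => (2 * g * #|supp w| < n)%N%:R) <= a ^+ (14 * n).
Proof.
apply: (@Ew_few_le setT _ n); last by rewrite cardsT card_ord -mulSnr.
move=> w /ltnW; rewrite setIT; apply: leq_trans.
by rewrite -mulnA mul2n -addnn leq_addr.
Qed.

(** * Random demands on a fixed typical pairing *)

Section Typical.
Variables (d d0 H m : nat) (s : {ffun half_edge n d -> half_edge n d}).
Hypotheses (led : (d0 <= d)%N) (d0_gt0 : (0 < d0)%N) (H15 : (15 <= H)%N).
Hypotheses (sP : s \in pairings n d) (typ : typical d0 (2 * g) H m s).
Local Notation G := (pairing_graph s).
Local Notation lows w := (low d0 (2 * g) s (supp w)).

Definition deg v : nat := #|[set u | (u != v) && G v u]|.

Lemma repeats_lt u v : u != v -> (H * repeats d0 s [set u; v] < d0)%N.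
Proof.
move=> uv; have /and3P[_ _ /existsPn/(_ (u, v))] := typ.
by rewrite /= uv /= -ltnNge.
Qed.

Lemma landing1_le v (W : {set 'I_n}) :
  (#|landing fst s (outs d d0 [set v]) :\: W| <= d0)%N.
Proof.
apply: leq_trans (subset_leq_card (subsetDl _ _)) _.
by apply: leq_trans (leq_imset_card _ _) _; rewrite card_outs // cards1 mul1n.
Qed.

Lemma landing_pair u v : landing fst s (outs d d0 [set u; v]) =
  landing fst s (outs d d0 [set u]) :|: landing fst s (outs d d0 [set v]).
Proof.
have -> : outs d d0 [set u; v] = outs d d0 [set u] :|: outs d d0 [set v].
  by apply/setP => h; rewrite !inE andb_orl.
exact: imsetU.
Qed.

Lemma landing_pair_le u v :
  (#|landing fst s (outs d d0 [set u; v]) :\: [set u; v]| <=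
    #|landing fst s (outs d d0 [set u]) :\: [set u; v]| +
    #|landing fst s (outs d d0 [set v]) :\: [set u; v]|)%N.
Proof.
rewrite landing_pair setDUl (leq_card_setU _ _).1 //.
Qed.

Lemma leq_landing_pair u v : u != v ->
  (2 * d0 <= #|landing fst s (outs d d0 [set u; v]) :\: [set u; v]| +
             repeats d0 s [set u; v])%N.
Proof.
move=> uv; apply: (@leq_trans #|outs d d0 [set u; v]|).
  by rewrite card_outs // cards2 uv.
by rewrite /repeats -leq_subLR.
Qed.

Lemma leq_landing1 u v : u != v ->
  (d0 <= #|landing fst s (outs d d0 [set u]) :\: [set u; v]| +
             repeats d0 s [set u; v])%N.
Proof.
move=> uv; have := leq_landing_pair uv; have := landing_pair_le u v.
have := landing1_le v [set u; v].
move: #|_ :\: _| #|_ :\: _| #|_ :\: _| (repeats _ _ _) => x y z r.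
rewrite mul2n -addnn => xd zxy dz; rewrite -(leq_add2r d0).
apply: leq_trans dz _; rewrite addnAC leq_add2r.
by apply: leq_trans zxy _; rewrite leq_add2l.
Qed.

Lemma repeats15 u v : u != v -> (15 * repeats d0 s [set u; v] < d0)%N.
Proof. by move=> /repeats_lt; apply: leq_ltn_trans; rewrite leq_mul2r H15 orbT. Qed.

Lemma deg_ge v (W : {set 'I_n}) : v \in W ->
  (#|landing fst s (outs d d0 [set v]) :\: W| <= deg v)%N.
Proof.
move=> vW; apply/subset_leq_card/subsetP => u /setDP[/imsetP[[x i]]].
rewrite !inE /= => /andP[/eqP-> _] -> uW; rewrite pairing_graphP andbT.
by apply: contraNneq uW => ->.
Qed.

Lemma hits_ge v (W S : {set 'I_n}) : v \in W ->
  (#|S :&: (landing fst s (outs d d0 [set v]) :\: W)| <= hits d0 s v (S :\ v))%N.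
Proof.
move=> vW; apply: leq_trans (leq_imset_card (fun i => (s (v, i)).1) _).
apply/subset_leq_card/subsetP => u /setIP[uS /setDP[/imsetP[[x i]]]].
rewrite !inE /= => /andP[/eqP-> id0] uE uW; apply/imsetP; exists i => //.
rewrite !inE id0 -uE uS andbT.
by apply: contraNneq uW => ->.
Qed.

(** The two exposures reach at least [29 d0 / 15] distinct vertices outside the pair. If both
    vertices are low, fewer than [d0 / (2g)] of these in S come from each, which is why lowness is
    taken with [2 * g]; [Ew_few_le] then applies. *)
Lemma Ew_low2 u v : u != v ->
  Ew (fun w => ((u \in lows w) && (v \in lows w))%:R) <= a ^+ (28 * d0).
Proof.
move=> uv; set C := landing fst s (outs d d0 [set u; v]) :\: [set u; v].
apply: (@Ew_few_le C _ d0) => [w|]; last first.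
  by rewrite -mulSnr; apply: cover_arith1 (leq_landing_pair uv) (repeats15 uv).
rewrite !inE => /andP[/andP[_ lu] /andP[_ lv]]; apply: (cover_arith3 _ lu lv).
have uW : u \in [set u; v] by rewrite !inE eqxx.
have vW : v \in [set u; v] by rewrite !inE eqxx orbT.
apply: leq_trans (leq_add (hits_ge (supp w) uW) (hits_ge (supp w) vW)).
apply: leq_trans (leq_card_setU _ _).1; apply: subset_leq_card.
by rewrite -setIUr -setDUl -landing_pair.
Qed.

(** Typicality only limits repeats at pairs, so an auxiliary vertex [u] is brought in; at least
    [14 d0 / 15] distinct targets of [v] remain, and 15 * 14/15 - 1 = 13. *)
Lemma Ew_low v : (1 < n)%N -> Ew (fun w => (v \in lows w)%:R) <= a ^+ (13 * d0).
Proof.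
move=> n1; have [u uv] : exists u, v != u.
  have /card_gt0P[u] : (0 < #|[set~ v]|)%N.
    by rewrite cardsC1 card_ord -subn1 subn_gt0.
  by rewrite !inE eq_sym => uv; exists u.
set C := landing fst s (outs d d0 [set v]) :\: [set v; u].
apply: (@Ew_few_le C _ d0) => [w|]; last first.
  by rewrite -mulSnr; apply: cover_arith2 (leq_landing1 uv) (repeats15 uv).
rewrite inE => /andP[_ lv].
have vW : v \in [set v; u] by rewrite !inE eqxx.
have le0 := hits_ge (supp w) vW.
apply: (@leq_trans (2 * g * hits d0 s v (supp w :\ v))); last exact: ltnW.
by rewrite -mulnA mul2n -addnn; apply: leq_trans (leq_addr _ _); rewrite leq_mul2l le0 orbT.
Qed.

Lemma isolated_low (S : {set 'I_n}) : isolated G S \subset low d0 (2 * g) s S.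
Proof.
apply/subsetP => v; rewrite !inE => /andP[vS /forall_inP noG]; rewrite vS /=.
rewrite /hits (_ : [set i : 'I_d | _] = set0) ?cards0 ?muln0 //.
apply/setP => i; rewrite !inE; apply/negP => /and3P[_ uv uS].
by have := noG _ uS; rewrite uv pairing_graphP.
Qed.

Lemma card_enlarge (X : {set 'I_n}) : (#|enlarge G X| <= #|X| * d.+1)%N.
Proof.
rewrite mulnS; apply: leq_trans (leq_card_setU _ _).1 _; rewrite leq_add2l.
rewrite -card_over; apply: leq_trans (leq_imset_card (fun h => (s h).1) _).
apply/subset_leq_card/subsetP => u; rewrite inE => /exists_inP[x xX].
move=> /existsP[i /existsP[j /eqP E]]; apply/imsetP; exists (x, i); last by rewrite E.
by rewrite inE.
Qed.

Lemma card_ball4 v : (#|ball4 G v| <= d.+1 ^ 4)%N.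
Proof.
have iter_le k : (#|iter k (enlarge G) [set v]| <= d.+1 ^ k)%N.
  elim: k => [|k IHk]; first by rewrite cards1.
  rewrite iterS expnSr; apply: leq_trans (card_enlarge _) _.
  by rewrite leq_mul2r IHk orbT.
exact: iter_le.
Qed.

Lemma card_sum_mem (S : {set 'I_n}) : #|S|%:R = \sum_v (v \in S)%:R :> R.
Proof. by rewrite -sum1_card natr_sum big_mkcond; apply: eq_bigr => v _; case: ifP. Qed.

Lemma Ew_card_isolated :
  Ew (fun w => #|isolated G (supp w)|%:R) = \sum_v p * (1 - p) ^+ deg v.
Proof.
rewrite -(eq_bigr _ (fun v _ => Ew_isolated G v)) -Ew_sum.
by apply: eq_bigr => w _; rewrite card_sum_mem.
Qed.

Lemma Ew_card_clustered :
  Ew (fun w => #|clustered G (lows w)|%:R) <= n%:R * d.+1%:R ^+ 4 * a ^+ (28 * d0).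
Proof.
apply: (@le_trans _ _ (\sum_v \sum_(u in ball4 G v | v != u)
    Ew (fun w => ((v \in lows w) && (u \in lows w))%:R))).
  under eq_bigr do rewrite -Ew_sum.
  rewrite -Ew_sum; apply: le_Ew => w; rewrite card_sum_mem; apply: ler_sum => v _.
  case: (boolP (v \in clustered _ _)) => [|_]; last by apply: sumr_ge0.
  rewrite inE => /andP[vL /exists_inP[u uL /andP[uv ub]]].
  rewrite (bigD1 u) /=; last by rewrite ub eq_sym.
  by rewrite vL uL lerDl sumr_ge0.
apply: (@le_trans _ _ (\sum_(v < n) d.+1%:R ^+ 4 * a ^+ (28 * d0))); last first.
  by rewrite sumr_const card_ord -[leLHS]mulr_natl mulrA.
apply: ler_sum => v _.
apply: (@le_trans _ _ (\sum_(u in ball4 G v) a ^+ (28 * d0))).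
  rewrite big_mkcondr; apply: ler_sum => u _; case: ifP => [uv|_]; first exact: Ew_low2.
  by rewrite exprn_ge0 // ltW.
rewrite sumr_const -[leLHS]mulr_natl ler_wpM2r ?exprn_ge0 ?(ltW a0) //.
by rewrite -natrX ler_nat card_ball4.
Qed.

Lemma Ew_card_low : (1 < n)%N ->
  Ew (fun w => #|lows w|%:R) <= n%:R * a ^+ (13 * d0).
Proof.
move=> n1; apply: (@le_trans _ _ (\sum_(v < n) a ^+ (13 * d0))); last first.
  by rewrite sumr_const card_ord -[leLHS]mulr_natl.
apply: (@le_trans _ _ (\sum_v Ew (fun w => (v \in lows w)%:R))).
  by rewrite -Ew_sum; apply: le_Ew => w; rewrite card_sum_mem.
by apply: ler_sum => v _; apply: Ew_low.
Qed.

Hypotheses (g_gt0 : (0 < g)%N) (m0 : (0 < m)%N) (mn : (6 * m * (2 * g) <= n)%N).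

Lemma missed_demand w : (n <= 2 * g * #|supp w|)%N ->
  exists2 f, fmatching G (demand_supp (demand_of R w)) f &
    (#|missed (demand_supp (demand_of R w)) f| <=
      (#|isolated G (supp w)| + 2 * #|clustered G (lows w)|).+1)%N.
Proof.
move=> nS; have g0 : (0 < 2 * g)%N by rewrite muln_gt0.
have [f fo] := exists_optimal G (supp w); exists f.
  by rewrite demand_supp_of; have /optimalP[] := fo.
rewrite demand_supp_of; apply: (missed_le_typical sP typ m0 _ fo).
by rewrite -(leq_pmul2r g0) (leq_trans mn) // mulnC.
Qed.

Lemma small_supp_cases (l b : toss -> R) :
  (forall w, l w <= n%:R) -> (forall w, 0 <= b w) ->
  (forall w, (n <= 2 * g * #|supp w|)%N -> l w <= b w) ->
  Ew l <= n%:R * a ^+ (14 * n) + Ew b.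
Proof.
move=> ln b0 lb.
apply: (@le_trans _ _ (Ew (fun w => n%:R * (2 * g * #|supp w| < n)%N%:R + b w))).
  apply: le_Ew => w; case: ltnP => [_|/lb le]; last by rewrite mulr0 add0r.
  by rewrite mulr1; apply: le_trans (ln w) _; rewrite lerDl.
by rewrite EwD EwZ lerD2r ler_wpM2l // Ew_small_supp.
Qed.

(** Used for fractional loss: the isolated vertices must keep coefficient one, since only the factor
    [p < 1] leaves room, while the additive 1 is negligible. *)
Lemma mean_loss_le_add : mean_loss p G <=
  n%:R * a ^+ (14 * n) +
    (1 + \sum_v p * (1 - p) ^+ deg v + 2 * (n%:R * d.+1%:R ^+ 4 * a ^+ (28 * d0))).
Proof.
rewrite mean_loss_Ew; apply: le_trans (small_supp_cases
  (b := fun w => 1 + #|isolated G (supp w)|%:R + 2 * #|clustered G (lows w)|%:R) _ _ _) _.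
- by move=> w; apply: loss_le_size.
- by move=> w; rewrite !addr_ge0 // mulr_ge0.
- move=> w /missed_demand[f fm le_f].
  apply: le_trans (loss_le_missed (pairing_graph_sym sP) fm) _.
  by rewrite -natrM -addrA -natrD nat1r ler_nat.
rewrite lerD2l !EwD Ew_cst EwZ Ew_card_isolated lerD2l ler_wpM2l //.
exact: Ew_card_clustered.
Qed.

Lemma loss_le_cluster w : (n <= 2 * g * #|supp w|)%N ->
  loss G (demand_of R w) <=
    2 * #|isolated G (supp w)|%:R + 4 * #|clustered G (lows w)|%:R.
Proof.
move=> /missed_demand[f fm le_f].
apply: le_trans (loss_le_double (pairing_graph_sym sP) fm le_f) _.
by rewrite -!natrM -natrD ler_nat -mul2n mulnDr mulnA.
Qed.

(** Used for logarithmic degrees: a factor two on the isolated vertices is affordable, an additive 1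
    is not. *)
Lemma mean_loss_le_double : mean_loss p G <=
  n%:R * a ^+ (14 * n) +
    (2 * (\sum_v p * (1 - p) ^+ deg v) + 4 * (n%:R * d.+1%:R ^+ 4 * a ^+ (28 * d0))).
Proof.
rewrite mean_loss_Ew; apply: le_trans (small_supp_cases _ _ loss_le_cluster) _.
- by move=> w; apply: loss_le_size.
- by move=> w; rewrite !addr_ge0 // mulr_ge0.
rewrite lerD2l EwD !EwZ Ew_card_isolated lerD2l ler_wpM2l //.
exact: Ew_card_clustered.
Qed.

(** Used for larger degrees, where balls of radius four are too big to count. Isolated and clustered
    vertices are all low, and 6 = 2 + 4. *)
Lemma mean_loss_le_low : (1 < n)%N ->
  mean_loss p G <= n%:R * a ^+ (14 * n) + 6 * (n%:R * a ^+ (13 * d0)).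
Proof.
move=> n1; rewrite mean_loss_Ew; apply: le_trans (small_supp_cases
  (b := fun w => 6 * #|lows w|%:R) _ _ _) _.
- by move=> w; apply: loss_le_size.
- by move=> w; rewrite mulr_ge0.
- move=> w /loss_le_cluster /le_trans; apply.
  rewrite -!natrM -natrD ler_nat (_ : 6 = 2 + 4)%N // mulnDl leq_add //.
    by rewrite leq_mul2l subset_leq_card ?isolated_low.
  rewrite leq_mul2l subset_leq_card //.
  by apply/subsetP => v; rewrite inE => /andP[].
by rewrite lerD2l EwZ ler_wpM2l // Ew_card_low.
Qed.

End Typical.
End Expectation.

(** * Asymptotics *)

Section Asymptotics.
Local Open Scope ring_scope.
Variable R : realType.

Lemma exists_natr_ge (x : R) : exists N : nat, forall n : nat, (N <= n)%N -> x <= n%:R.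
Proof.
exists (Num.truncn x).+1 => n nN; apply: ltW.
by apply: lt_le_trans (truncnS_gt x) _; rewrite ler_nat.
Qed.

Lemma exists_powR_ge (r x : R) : 0 < r ->
  exists N : nat, forall n : nat, (N <= n)%N -> x <= n%:R `^ r.
Proof.
move=> r0; pose y := Num.max x 1.
have [N HN] := exists_natr_ge (y `^ r^-1); exists N => n /HN le.
apply: le_trans (_ : y <= _); first by rewrite le_max lexx.
have y0 : 0 <= y by rewrite le_max ler01 orbT.
have -> : y = (y `^ r^-1) `^ r by rewrite -powRrM mulVf ?gt_eqF ?powRr1.
by apply: ge0_ler_powR; rewrite ?nnegrE ?powR_ge0 ?(ltW r0) //.
Qed.

Lemma ln_le_powR (r c : R) : 0 < r -> 0 < c ->
  exists N : nat, forall n : nat, (N <= n)%N -> ln n%:R <= c * n%:R `^ r.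
Proof.
move=> r0 c0; have r20 : 0 < r / 2 by rewrite divr_gt0.
have [N HN] := exists_powR_ge ((r / 2)^-1 / c) r20.
exists N.+1 => n nN; have n0 : 0 < n%:R :> R by rewrite ltr0n (leq_trans _ nN).
have /HN le := ltnW nN; rewrite ler_pdivrMr // in le.
have -> : n%:R `^ r = n%:R `^ (r / 2) * n%:R `^ (r / 2) :> R.
  by rewrite -powRD -?splitr // gt_eqF ?implybT.
have pos : 0 < n%:R `^ (r / 2) :> R by rewrite powR_gt0.
have -> : ln n%:R = (r / 2)^-1 * ln (n%:R `^ (r / 2)) :> R.
  by rewrite ln_powR mulKf ?gt_eqF.
apply: (@le_trans _ _ ((r / 2)^-1 * n%:R `^ (r / 2))).
  by rewrite ler_pM2l ?invr_gt0 //; apply/ltW/ln_sublinear.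
by rewrite mulrA ler_pM2r // [leRHS]mulrC.
Qed.

Lemma powR_expR (n : nat) (r : R) : (0 < n)%N -> n%:R `^ r = expR (r * ln n%:R).
Proof. by move=> n0; rewrite /powR pnatr_eq0 gtn_eqF. Qed.

Lemma exprn_expR (x : R) k : 0 < x -> x ^+ k = expR (k%:R * ln x).
Proof. by move=> x0; rewrite expRM_natl lnK. Qed.

Lemma expr_le_invn (x : R) b : 0 < x -> x < 1 ->
  exists N : nat, forall n : nat, (N <= n)%N -> x ^+ n <= (n%:R^-1) ^+ b.
Proof.
move=> x0 x1; have lx : ln x < 0 by rewrite ln_lt0 // x0.
have c0 : 0 < - ln x / b.+1%:R by rewrite divr_gt0 // oppr_gt0.
have [N HN] := @ln_le_powR 1 _ ltr01 c0.
exists N.+1 => n nN; have n0 : (0 < n)%N by apply: leq_trans nN.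
have /HN := ltnW nN; rewrite powRr1 // => le.
have n0R : 0 < n%:R :> R by rewrite ltr0n.
rewrite !exprn_expR ?invr_gt0 // ler_expR lnV ?posrE // mulrN lerNr -mulrN.
have ln0 : 0 <= ln n%:R :> R by rewrite ln_ge0 // ler1n.
apply: (@le_trans _ _ (b.+1%:R * ln n%:R)).
  by rewrite ler_wpM2r // ler_nat.
rewrite mulrAC ler_pdivlMr // in le.
by rewrite mulrC [leRHS]mulrC.
Qed.

Lemma exists_expr_le (x y : R) : 0 < x -> x < 1 -> 0 < y ->
  exists N : nat, forall n : nat, (N <= n)%N -> x ^+ n <= y.
Proof.
move=> x0 x1 y0; have [N HN] := expr_le_invn 1 x0 x1.
have [N' HN'] := exists_natr_ge y^-1.
exists (maxn N N').+1 => n; rewrite gtn_max => /andP[nN nN'].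
have n0 : 0 < n%:R :> R by rewrite ltr0n (leq_ltn_trans _ nN).
apply: le_trans (HN _ (ltnW nN)) _; rewrite expr1.
by have := HN' _ (ltnW nN'); rewrite -[in X in _ -> X](invrK y) lef_pV2 ?posrE ?invr_gt0.
Qed.

(** With [a = q^(1/16)], the gap between [q] and [a^15] is filled exactly by [p t]; then [g] is
    taken so large that [a^g <= t]. Tilting the demands by [t] costs only one sixteenth of the
    exponent. *)
Lemma exists_tilt (p : R) : 0 < p -> p < 1 ->
  exists (a t : R) (g : nat), [/\ 0 < a, a < 1 & a ^+ 16 = 1 - p] /\
    [/\ 0 < t, (0 < g)%N, a ^+ g <= t & 1 - p + p * t <= a ^+ 15].
Proof.
move=> p0 p1; have q0 : 0 < 1 - p by rewrite subr_gt0.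
pose a := (1 - p) `^ 16^-1.
have a0 : 0 < a by rewrite powR_gt0.
have a16 : a ^+ 16 = 1 - p.
  by rewrite -powR_mulrn ?(ltW a0) // -powRrM mulVf ?powRr1 ?(ltW q0) // pnatr_eq0.
have a1 : a < 1.
  rewrite ltNge; apply/negP => a1.
  by have := exprn_ege1 16 a1; rewrite a16; move: p0; clear; lra.
have a15 : 1 - p < a ^+ 15.
  by rewrite -a16 exprSr gtr_pMr ?exprn_gt0.
pose t := (a ^+ 15 - (1 - p)) / p.
have t0 : 0 < t by rewrite divr_gt0 // subr_gt0.
have [N HN] := exists_expr_le a0 a1 t0.
exists a, t, N.+1; split=> //; split=> //; first exact: HN.
by rewrite mulrC divfK ?gt_eqF // subrKC.
Qed.

(** Each of the three events is made at most [n^-(b+1)], and [3 / n <= 1]. The constants precede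
    [n], [d] and [d0], so the same bound serves constant and growing degrees. *)
Lemma atypical_rare g H b : (0 < g)%N -> (0 < H)%N ->
  exists M D0 C N : nat, [/\ (0 < M)%N, (6 * g <= M)%N, (M <= N)%N &
    forall n d d0, (N <= n)%N -> (d0 <= d)%N -> (D0 <= d0)%N ->
      (C * d0.+1 ^ 2 <= n)%N ->
      \sum_(s in pairings n d | ~~ typical d0 g H (n %/ M) s) 1 <=
        (n%:R^-1) ^+ b * #|pairings n d|%:R :> R].
Proof.
move=> g0 H0.
pose C0 : R := 16 * expR 4.
have [M0 HM0] := exists_natr_ge (4 * (C0 * 2 ^+ (16 * g))).
pose M := maxn M0 (maxn (6 * g) 1).
have M1 : (0 < M)%N by rewrite !leq_max /= !orbT.
have M6 : (6 * g <= M)%N by rewrite !leq_max leqnn /= orbT.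
have CM : 4 * (C0 * 2 ^+ (16 * g)) <= M%:R by rewrite HM0 // leq_max leqnn.
clearbody M.
have MR : 0 < (2 * M%:R)^-1 :> R by rewrite invr_gt0 mulr_gt0 // ltr0n.
have MR' : (2 * M%:R)^-1 <= 2^-1 :> R.
  rewrite lef_pV2 ?posrE ?mulr_gt0 ?ltr0n //.
  by rewrite -[leLHS]mulr1 ler_pM2l // ler1n.
have b0 : 0 < 1 - (2 * M%:R)^-1 :> R.
  by move: MR'; move: (2 * M%:R)^-1 => y; lra.
have b1 : 1 - (2 * M%:R)^-1 < 1 :> R by rewrite gtrBl.
have b8 : 0 < 8^-1 :> R by rewrite invr_gt0.
have [j Hj] := exists_expr_le b0 b1 b8; have {}Hj := Hj _ (leqnn j).
have half0 : 0 < 2^-1 :> R by rewrite invr_gt0.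
have half1 : 2^-1 < 1 :> R by rewrite invf_lt1 // ltr1n.
have [N2 HN2] := expr_le_invn b.+1 half0 half1.
(* Factors are grouped in pairs worth at most [1 / n] each; of these [b + 3], two pay for the [n^2]
   pairs of vertices in an overlap. *)
pose k0 := (2 * b.+3)%N.
pose D0 := maxn (8 * g * k0) (maxn (2 * (2 * M * j)) (2 * H * k0)).
exists M, D0, (4 ^ (2 * (4 * H).+1))%N, (maxn M (maxn N2 16)).
split=> //; first by rewrite leq_max leqnn.
move=> n d d0; rewrite !geq_max => /and3P[Mn N2n n16] led /and3P[D1 D2 D3] Cn.
have n0 : (0 < n)%N by apply: leq_trans n16.
have nR : 0 < n%:R :> R by rewrite ltr0n.
have k00 : (0 < k0)%N by [].
have d00 : (0 < d0)%N by apply: leq_trans D1; rewrite !muln_gt0 g0.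
pose x : R := n%:R^-1.
have x0 : 0 < x by rewrite invr_gt0.
have x1 : x <= 1 by rewrite invf_le1 // ler1n.
have x3 : 3 * x <= 1.
  by rewrite ler_pdivrMr // mul1r (ler_nat R 3) (leq_trans _ n16).
pose P : R := #|pairings n d|%:R.
have P0 : 0 <= P by [].
have B1 : \sum_(s in pairings n d | dense_pair d0 g (n %/ M) s) 1 <= x ^+ b.+1 * P.
  have kk : (k0 <= d0 %/ g %/ 2 %/ 4)%N.
    rewrite -!divnMA leq_divRL ?muln_gt0 ?g0 //.
    by apply: leq_trans D1; apply: eq_leq; ring.
  apply: le_trans (sum_dense_pair led d00 g0 n0 M1 CM _) _; first exact: leq_trans kk.
  rewrite ler_wpM2r // -/x.
  apply: (@le_trans _ _ (n%:R * (4 / n%:R) ^+ k0)).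
    rewrite ler_pM2l //; apply: ler_wiXn2l => //; first by rewrite divr_ge0.
    by rewrite ler_pdivrMr // mul1r (ler_nat R 4) (leq_trans _ n16).
  rewrite /k0 exprM; apply: (@le_trans _ _ (n%:R * x ^+ b.+3)).
    rewrite ler_pM2l //; apply: lerXn2r; rewrite ?nnegrE ?exprn_ge0 ?(ltW x0) //.
    have n16R : 16 <= n%:R :> R by rewrite (ler_nat R 16).
    rewrite exprMn expr2 -/x mulrA -[leRHS]mul1r ler_pM2r //.
    rewrite ler_pdivrMr // mul1r; apply: le_trans n16R; lra.
  rewrite exprS mulrA divff ?gt_eqF // mul1r exprS -[leRHS]mul1r.
  by rewrite ler_wpM2r ?exprn_ge0 ?(ltW x0).
have B2 : \sum_(s in pairings n d | distant_pair (n %/ M) s) 1 <= x ^+ b.+1 * P.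
  apply: le_trans (sum_distant_pair led d00 M1 Mn Hj _) _.
    by rewrite leq_divRL // mulnC.
  by rewrite ler_wpM2r // HN2.
have B3 : \sum_(s in pairings n d | overlapping_pair d0 H s) 1 <= x ^+ b.+1 * P.
  set k := (d0 %/ (2 * H))%N; pose rho : R := 4 * d0.+1%:R / n%:R.
  have kk : (k0 <= k)%N by rewrite leq_divRL ?muln_gt0 // mulnC.
  (* As [d0 <= 4 * H * k], the factor [4 ^+ d0] is shared among the [k] factors [rho]. The condition
     [C * d0.+1 ^ 2 <= n] says exactly that [y ^+ 2 <= 1 / n]. *)
  pose y : R := 4 ^+ (4 * H) * rho.
  have rho0 : 0 <= rho by rewrite divr_ge0 ?mulr_ge0.
  have y0 : 0 <= y by rewrite mulr_ge0 // exprn_ge0.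
  have y2 : y ^+ 2 <= x.
    have -> : y = (4 ^ (4 * H).+1 * d0.+1)%N%:R * x.
      by rewrite /y /rho natrM natrX exprSr !mulrA.
    rewrite exprMn [x ^+ 2]expr2 mulrA -[leRHS]mul1r ler_pM2r //.
    rewrite /x ler_pdivrMr // mul1r -natrX ler_nat; apply: leq_trans Cn.
    by rewrite expnMn -expnM [(_.+1 * 2)%N]mulnC.
  have y1 : y <= 1.
    by rewrite -(@expr_le1 _ 2) // (le_trans y2).
  have ry : rho <= y.
    by rewrite -[leLHS]mul1r ler_wpM2r // exprn_ege1 // ler1n.
  have n8 : (8 <= n)%N by apply: leq_trans n16.
  apply: le_trans (sum_overlapping_pair led H0 n8 (le_trans ry y1)) _.
  rewrite ler_wpM2r // -/k -/rho.
  have d0k : (d0 <= 4 * H * k)%N.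
    apply: ltnW; apply: leq_trans (ltn_ceil d0 (_ : 0 < 2 * H)%N) _; first by rewrite muln_gt0.
    rewrite -/k (_ : 4 * H * k = (k + k) * (2 * H))%N; last by ring.
    by apply: leq_mul => //; rewrite -[leqLHS]addn1 leq_add2l (leq_trans k00 kk).
  apply: (@le_trans _ _ (n%:R ^+ 2 * y ^+ k)).
    have -> : y ^+ k = 4 ^+ (4 * H * k) * rho ^+ k by rewrite [LHS]exprMn -exprM.
    rewrite -mulrA ler_pM2l ?exprn_gt0 // ler_wpM2r ?exprn_ge0 //.
    by rewrite ler_weXn2l // ler1n.
  apply: (@le_trans _ _ (n%:R ^+ 2 * x ^+ b.+3)).
    rewrite ler_pM2l ?exprn_gt0 //; apply: (@le_trans _ _ (y ^+ k0)).
      exact: ler_wiXn2l.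
    by rewrite /k0 exprM; apply: lerXn2r; rewrite ?nnegrE ?exprn_ge0 ?(ltW x0).
  have -> : x ^+ b.+3 = x ^+ b.+1 * x ^+ 2 by rewrite -exprD addn2.
  by rewrite mulrCA -exprMn mulfV ?gt_eqF // expr1n mulr1.
apply: (@le_trans _ _ (x ^+ b.+1 * P + x ^+ b.+1 * P + x ^+ b.+1 * P)); last first.
  rewrite -!mulrDl ler_wpM2r // exprS -/x.
  have xb : 0 <= x ^+ b by rewrite exprn_ge0 // ltW.
  by move: (x ^+ b) xb x3 => z z0 x3; nra.
apply: le_trans (lerD (lerD B1 B2) B3).
rewrite [leLHS]big_mkcondr ![in leRHS]big_mkcondr -!big_split /=.
apply: ler_sum => s _; rewrite /typical !negb_and !negbK.
by case: (dense_pair _ _ _ _); case: (distant_pair _ _); case: (overlapping_pair _ _ _);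
  rewrite /= ?addr0 ?add0r // ?lerDl ?lerDr ?addr_ge0.
Qed.

End Asymptotics.

(** * From typical pairings to the configuration model *)

Section ModelExpectation.
Local Open Scope ring_scope.
Variable R : realType.

Lemma mean_loss_le_size n (p : R) (G : rel 'I_n) : 0 < p -> p < 1 -> mean_loss p G <= n%:R.
Proof.
move=> p0 p1; rewrite -[leRHS](Ew_cst n p); apply: le_Ew => // w.
exact: loss_le_size.
Qed.

Variables n d : nat.
Hypothesis ev : ~~ odd (n * d).
Let T := {ffun half_edge n d -> half_edge n d}.

Let P0 : 0 < #|pairings n d|%:R :> R.
Proof. by rewrite ltr0n card_pairings_gt0. Qed.

Lemma cm_probability_ge (A : pred (rel 'I_n)) (B : pred T) (x : R) :
  (forall s, s \in pairings n d -> ~~ B s -> A (pairing_graph s)) ->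
  \sum_(s in pairings n d | B s) 1 <= x * #|pairings n d|%:R ->
  1 - x <= cm_probability d R A.
Proof.
move=> BA Bx; rewrite /cm_probability ler_pdivlMr // mulrBl mul1r lerBlDr.
apply: le_trans (lerD (lexx _) Bx).
rewrite -[leLHS]sumr_const (bigID B) /= addrC lerD2r.
rewrite -[leRHS]sumr_const big_mkcondr [leRHS]big_mkcond /= [leLHS]big_mkcond.
apply: ler_sum => s _; case: ifP => [sP|_]; last by case: ifP.
case: ifP => [nB|_]; last by case: ifP.
by rewrite (_ : _ \in _) // inE sP (BA _ sP nB).
Qed.

Lemma cm_probability_le1 (A : pred (rel 'I_n)) : cm_probability d R A <= 1.
Proof.
rewrite /cm_probability ler_pdivrMr // mul1r ler_nat; apply: subset_leq_card.
by apply/fintype.subsetP => s; rewrite inE => /andP[].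
Qed.

Lemma cm_expectation_le (f : rel 'I_n -> R) (B : pred T) (x y M : R) :
  0 <= M -> 0 <= y -> (forall G, f G <= M) ->
  (forall s, s \in pairings n d -> ~~ B s -> f (pairing_graph s) <= y) ->
  \sum_(s in pairings n d | B s) 1 <= x * #|pairings n d|%:R ->
  cm_expectation d f <= M * x + y.
Proof.
move=> M0 y0 fM fy Bx; rewrite /cm_expectation ler_pdivrMr // mulrDl -mulrA.
apply: le_trans (lerD (ler_wpM2l M0 Bx) (lexx _)).
rewrite mulr_natr -sumr_const mulr_sumr [X in _ <= X + _]big_mkcondr -big_split /=.
apply: ler_sum => s sP; case: ifPn => [_|/(fy _ sP)]; last by rewrite add0r.
by rewrite mulr1; apply: le_trans (fM _) _; rewrite lerDl.
Qed.

(** For constant [d], a given vertex has a repeat with probability of order [n^(-1/2)]. By Markov's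
    inequality all but a small fraction of the vertices have [d] distinct neighbours. *)
Lemma sum_bad_vertices (eta : R) : (8 <= n)%N -> 0 < eta -> 4 * d.+1%:R / n%:R <= 1 :> R ->
  \sum_(s in pairings n d | eta * n%:R < #|[set v | (0 < repeats d s [set v])%N]%SET|%:R) 1 <=
    2 ^+ d * Num.sqrt (4 * d.+1%:R / n%:R) / eta * #|pairings n d|%:R.
Proof.
move=> n8 eta0 rho1; have n0 : 0 < n%:R :> R by rewrite ltr0n (leq_trans _ n8).
have en0 : 0 < eta * n%:R by rewrite mulr_gt0.
rewrite -(ler_pM2l en0) mulr_sumr.
apply: (@le_trans _ _ (\sum_(s in pairings n d) \sum_v ((0 < repeats d s [set v]%SET)%N)%:R)).
  rewrite big_mkcondr; apply: ler_sum => s _; rewrite mulr1.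
  have -> : \sum_v ((0 < repeats d s [set v]%SET)%N)%:R =
      #|[set v | (0 < repeats d s [set v])%N]%SET|%:R :> R.
    by rewrite card_sum_mem; apply: eq_bigr => v _; rewrite inE.
  by case: ifP => [/ltW|].
rewrite exchange_big /=.
have -> : eta * n%:R * (2 ^+ d * Num.sqrt (4 * d.+1%:R / n%:R) / eta * #|pairings n d|%:R) =
    \sum_(v < n) 2 ^+ d * Num.sqrt (4 * d.+1%:R / n%:R) * #|pairings n d|%:R.
  rewrite sumr_const card_ord -[RHS]mulr_natl.
  move: (2 ^+ d) (Num.sqrt _) #|pairings n d|%:R => x y z.
  by field; rewrite gt_eqF.
apply: ler_sum => v _.
have := @sum_repeats R n d d (leqnn d) [set v]%SET 1 n8.
rewrite cards1 mul1n expr1 => /(_ isT rho1); apply: le_trans.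
by rewrite [leRHS]big_mkcondr; apply: ler_sum => s _; case: ifP.
Qed.

End ModelExpectation.

(** * Fractional loss at constant degree *)

Section FractionalLoss.
Local Open Scope ring_scope.
Variables (R : realType) (p : R).
Hypotheses (p0 : 0 < p) (p1 : p < 1).
Let q := 1 - p.

Let q0 : 0 < q. Proof. by rewrite subr_gt0. Qed.
Let q1 : q < 1. Proof. by rewrite gtrBl. Qed.

Lemma sum_deg_le n d (s : {ffun half_edge n d -> half_edge n d}) :
  \sum_v p * q ^+ deg s v <=
    n%:R * (p * q ^+ d) + #|[set v | (0 < repeats d s [set v])%N]%SET|%:R.
Proof.
rewrite card_sum_mem mulr_natl -[X in _ *+ X]card_ord -sumr_const -big_split /=.
apply: ler_sum => v _; rewrite inE; case: posnP => [r0|_].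
  rewrite addr0 ler_pM2l //; apply: ler_wiXn2l; rewrite ?ltW //.
  apply: leq_trans (@deg_ge n d d s v [set v]%SET _); last by rewrite inE.
  have := r0; rewrite /repeats => /eqP.
  by rewrite subn_eq0 card_outs // cards1 mul1n.
rewrite -[leLHS]add0r lerD //.
  by rewrite mulr_ge0 ?exprn_ge0 // ltW.
rewrite -[leRHS]mulr1; apply: ler_pM; rewrite ?exprn_ge0 ?(ltW p0) ?(ltW p1) ?(ltW q0) //.
by rewrite exprn_ile1 // ltW.
Qed.

Lemma q_pow_le (d : nat) (x : R) : 0 < x -> ln (1 / x) / ln (1 / q) <= d%:R -> q ^+ d <= x.
Proof.
move=> x0; have L0 : 0 < ln (1 / q) by rewrite ln_gt0 // div1r invf_gt1.
rewrite ler_pdivrMr // !div1r !lnV ?posrE // mulrN lerNr opprK => le.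
by rewrite exprn_expR // -[leRHS](lnK x0) ler_expR.
Qed.

(* a^12 = q^(3/4) absorbs the number of vertices within distance four. *)
Lemma exists_large_degree (a : R) : 0 < a -> a < 1 ->
  exists D : nat, forall d : nat, (D <= d)%N ->
    2 * (d.+1%:R ^+ 4 * a ^+ (12 * d)) <= q / 4.
Proof.
move=> a0 a1; have b0 : 0 < a ^+ 12 by rewrite exprn_gt0.
have b1 : a ^+ 12 < 1 by rewrite exprn_ilt1 // ltW.
have [N HN] := expr_le_invn 5 b0 b1.
have [N' HN'] := exists_natr_ge (32 / (q / 4)).
exists (maxn N N').+1 => d; rewrite gtn_max => /andP[/ltnW Nd /[dup] N'd /ltnW/HN' le].
have d0 : 0 < d%:R :> R by rewrite ltr0n (leq_ltn_trans _ N'd).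
have q40 : 0 < q / 4 by rewrite divr_gt0.
have d1 : d.+1%:R <= 2 * d%:R :> R.
  by rewrite -natrM ler_nat mul2n -addnn -addn1 leq_add2l -(ltr0n R).
apply: (@le_trans _ _ (2 * ((2 * d%:R) ^+ 4 * d%:R^-1 ^+ 5))).
  rewrite ler_pM2l //; apply: ler_pM; rewrite ?exprn_ge0 ?(ltW a0) //.
    by apply: lerXn2r; rewrite ?nnegrE // mulr_ge0.
  by rewrite exprM HN.
have -> : 2 * ((2 * d%:R) ^+ 4 * d%:R^-1 ^+ 5) = 32 / d%:R :> R.
  by move: d%:R d0 => y y0; field; rewrite gt_eqF.
by rewrite ler_pdivrMr // mulrC -ler_pdivrMr.
Qed.

Lemma fractional_loss_params : exists (a : R) (D : nat), [/\ 0 < a, a < 1, a ^+ 16 = q &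
  forall (d : nat) (eta : R), (D <= d)%N -> 0 < eta -> exists N : nat, forall n : nat,
    (N <= n)%N -> ~~ odd (n * d) ->
    1 - (n%:R^-1 + 2 ^+ d * Num.sqrt (4 * d.+1%:R / n%:R) / eta) <=
    cm_probability d R (fun G : rel 'I_n => mean_loss p G <=
      n%:R * a ^+ (14 * n) + (1 + (n%:R * (p * q ^+ d) + eta * n%:R) +
         2 * (n%:R * d.+1%:R ^+ 4 * a ^+ (28 * d))))].
Proof.
have [a [t [g [[a0 a1 a16] [t0 g0 atg qa]]]]] := exists_tilt p0 p1.
have gg0 : (0 < 2 * g)%N by rewrite muln_gt0.
have [M [D [C [N [M0 M6 MN rare]]]]] := @atypical_rare R (2 * g) 15 1 gg0 isT.
exists a, D.+1; split=> // d eta Dd eta0.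
pose N' := (maxn N (maxn 8 (maxn (C * d.+1 ^ 2) (4 * d.+1))))%N.
exists N' => n; rewrite !geq_max => /and4P[Nn n8 Cn n4] ev.
have n0 : 0 < n%:R :> R by rewrite ltr0n (leq_trans _ n8).
have rho1 : 4 * d.+1%:R / n%:R <= 1 :> R.
  by rewrite ler_pdivrMr // mul1r -natrM ler_nat.
have d_gt0 : (0 < d)%N by apply: leq_trans Dd.
pose X (s : {ffun half_edge n d -> half_edge n d}) :=
  #|[set v | (0 < repeats d s [set v])%N]%SET|.
apply: (@cm_probability_ge R n d ev _ (fun s =>
  ~~ typical d (2 * g) 15 (n %/ M) s || (eta * n%:R < (X s)%:R))).
  move=> s sP; rewrite negb_or negbK -leNgt => /andP[typ Xs].
  have m0 : (0 < n %/ M)%N by rewrite divn_gt0 // (leq_trans MN).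
  have mn : (6 * (n %/ M) * (2 * g) <= n)%N.
    apply: leq_trans (leq_trunc_div n M).
    by rewrite mulnC mulnA mulnC leq_mul2l mulnC M6 orbT.
  apply: le_trans (mean_loss_le_add p0 p1 a0 a1 t0 atg qa (leqnn d) (leqnn 15) sP typ
                     g0 m0 mn) _.
  rewrite lerD2l lerD2r lerD2l; apply: le_trans (sum_deg_le s) _.
  by rewrite lerD2l.
rewrite mulrDl; apply: le_trans (lerD
  (rare n d d Nn (leqnn d) (ltnW Dd) Cn) (sum_bad_vertices n8 eta0 rho1)).
rewrite [leLHS]big_mkcondr ![in leRHS]big_mkcondr -big_split /=.
apply: ler_sum => s _; rewrite -/(X s).
by case: (typical _ _ _ _ _); case: (_ < _); rewrite /= ?addr0 ?add0r // lerDl.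
Qed.

Lemma sqrt_tail (c e : R) : 0 < e -> 0 <= c -> exists N : nat, forall n : nat, (N <= n)%N ->
  n%:R^-1 + Num.sqrt (c / n%:R) <= e.
Proof.
move=> e0 c0; have [N HN] := exists_natr_ge (2 / e).
have [N' HN'] := exists_natr_ge (c / (e / 2) ^+ 2).
exists (maxn N N').+1 => n; rewrite gtn_max => /andP[/[dup] Nn /ltnW/HN le1 /ltnW/HN' le2].
have n0 : 0 < n%:R :> R by rewrite ltr0n (leq_ltn_trans _ Nn).
have e20 : 0 < e / 2 by rewrite divr_gt0.
rewrite [leRHS]splitr lerD //.
  by rewrite -[leRHS]invrK lef_pV2 ?posrE ?invr_gt0 // invf_div.
rewrite -[leRHS]ger0_norm ?(ltW e20) // -sqrtr_sqr ler_wsqrtr //.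
by rewrite ler_pdivrMr // mulrC -ler_pdivrMr // exprn_gt0.
Qed.

End FractionalLoss.

Section ExponentArithmetic.
Local Open Scope ring_scope.
Variable R : realFieldType.
Implicit Types delta l x y c L : R.

Lemma tail_arith delta l c : (1 + delta) * l <= c * l -> 0 <= delta * l ->
  l + c * - l <= - (delta / 8) * l.
Proof. by lra. Qed.

Lemma deg_arith delta l y : 8 * (1 + delta) * l <= 7 * delta * y * l ->
  y * ((1 + delta / 8) * l) <= (y - 1) * ((1 + delta) * l).
Proof. by lra. Qed.

Lemma sum_deg_arith delta l : l + - (1 + delta / 8) * l <= - (delta / 8) * l.
Proof. by lra. Qed.

Lemma cluster_arith delta l x L : (1 + delta) * l <= x * L -> 0 <= delta * l ->
  0 <= l -> l + l / 2 - 28 * x / 16 * L <= - (delta / 8) * l.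
Proof. by lra. Qed.

Lemma low_arith delta l x L : 2 * (1 + delta) * l <= x * L -> 0 <= delta * l ->
  0 <= l -> l - 13 * x / 16 * L <= - (delta / 8) * l.
Proof. by lra. Qed.

Lemma cut_arith c x l y : 2 * (c * x) * l <= y -> 4 * c <= y -> c * (x * l + 1 + 1) <= y.
Proof. by lra. Qed.

End ExponentArithmetic.

(** * The two regimes of loss *)

Section MainResults.
Local Open Scope ring_scope.
Variables (R : realType) (p : R).
Hypotheses (p0 : 0 < p) (p1 : p < 1).
Let q := 1 - p.

Let q0 : 0 < q. Proof. by rewrite subr_gt0. Qed.
Let q1 : q < 1. Proof. by rewrite gtrBl. Qed.
Let L0 : 0 < ln (1 / q). Proof. by rewrite ln_gt0 // div1r invf_gt1. Qed.

Lemma cm_probability_mono n d (A A' : pred (rel 'I_n)) : (forall G, A G -> A' G) ->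
  cm_probability d R A <= cm_probability d R A'.
Proof.
move=> AA'; rewrite /cm_probability ler_wpM2r ?invr_ge0 // ler_nat.
apply: subset_leq_card; apply/fintype.subsetP => s; rewrite !inE => /andP[-> /AA' ->].
by [].
Qed.

(** The budget, in units of [eps n]: [p] for isolated vertices, [q / 8] for the additive constants,
    [q / 8] for vertices with repeats, [q / 4] for clusters. The sum is [p + q / 2 <= 1]. *)
Lemma fractional_arith (n eps A B C D E : R) : 0 <= n -> 0 <= eps ->
  A <= 1 -> 2 <= q * eps / 8 * n -> 0 <= B -> B <= eps -> C = q * eps / 8 ->
  0 <= E -> E <= q / 4 -> D = B * E ->
  A + (1 + (n * (p * B) + C * n) + n * D) <= eps * n.
Proof.
move=> n0 eps0 A1 n2 B0 Be -> E0 Eq ->.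
have h1 : n * (p * B) <= n * (p * eps).
  by apply: ler_wpM2l => //; apply: ler_wpM2l => //; exact: ltW.
have h2 : n * (B * E) <= n * (eps * (q / 4)).
  by apply: ler_wpM2l => //; apply: ler_pM.
have h3 : p = 1 - q by rewrite /q opprB addrC subrK.
have h4 : 0 <= n * eps * q by rewrite !mulr_ge0 // ltW.
apply: (@le_trans _ _ (2 + n * (p * eps) + q * eps / 8 * n + n * (eps * (q / 4)))).
  by move: h1 h2 A1; move: (n * (B * E)) (n * (p * B)) => x y; lra.
rewrite h3; move: n2 h4; clear => n2 h4; lra.
Qed.

Lemma fractional_loss : exists eps0 c : R, [/\ 0 < eps0, 0 < c &
     forall (eps : R) (d : nat),
       0 < eps -> eps < eps0 ->
       (ln (1 / eps) + c * eps * ln (1 / eps) ^+ 2) / ln (1 / q) <= d%:R ->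
       forall e : R, 0 < e -> exists N : nat, forall n : nat,
         (N <= n)%N -> ~~ odd (n * d) ->
         1 - e <= cm_probability d R (fun G : rel 'I_n => mean_loss p G <= eps * n%:R)].
Proof.
have [a [D [a0 a1 a16 params]]] := fractional_loss_params p0 p1.
have [D' HD'] := exists_large_degree p1 a0 a1.
(* With this threshold, [q ^+ d <= eps < q ^+ D1] forces [d] above both degree bounds. *)
pose D1 := maxn D D'; exists (q ^+ D1), 1; split=> [||eps d eps0 le_eps hd e e0].
- by rewrite exprn_gt0.
- by [].
have qd : q ^+ d <= eps.
  apply: q_pow_le => //; apply: le_trans hd.
  by rewrite ler_pM2r ?invr_gt0 // lerDl mul1r mulr_ge0 ?exprn_even_ge0 // ltW.
have D1d : (D1 <= d)%N.
  rewrite leqNgt; apply/negP => /ltnW dD1; have := le_lt_trans qd le_eps.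
  by rewrite ltNge => /negP; apply; apply: ler_wiXn2l; rewrite ?ltW.
move: D1d; rewrite geq_max => /andP[Dd D'd].
pose eta := q * eps / 8.
have eta0 : 0 < eta by rewrite divr_gt0 // mulr_gt0.
have [N1 H1] := params d eta Dd eta0.
have c0 : 0 <= (2 ^+ d / eta) ^+ 2 * (4 * d.+1%:R).
  by rewrite mulr_ge0 ?exprn_ge0 ?divr_ge0 ?mulr_ge0 // ltW.
have [N2 H2] := sqrt_tail e0 c0.
have b0 : 0 < a ^+ 14 by rewrite exprn_gt0.
have b1 : a ^+ 14 < 1 by rewrite exprn_ilt1 // ltW.
have [N3 H3] := expr_le_invn 1 b0 b1.
have [N4 H4] := exists_natr_ge (2 / eta).
exists (maxn (maxn N1 N2) (maxn N3 (maxn N4 1))) => n.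
rewrite !geq_max => /andP[/andP[n1 n2] /and3P[n3 n4 n5]] ev.
have nR : 0 < n%:R :> R by rewrite ltr0n.
apply: (@le_trans _ _ (1 - (n%:R^-1 + 2 ^+ d * Num.sqrt (4 * d.+1%:R / n%:R) / eta))).
  rewrite lerD2l lerN2; apply: le_trans (H2 n n2); rewrite lerD2l.
  rewrite -[(_ ^+ 2 * _) / n%:R]mulrA [leRHS]sqrtrM; last first.
    by rewrite exprn_ge0 // divr_ge0 ?exprn_ge0 // ltW.
  rewrite sqrtr_sqr ger0_norm; last first.
    by rewrite divr_ge0 ?exprn_ge0 // ltW.
  by rewrite mulrAC.
apply: le_trans (H1 n n1 ev) _; apply: cm_probability_mono => G.
move/le_trans; apply.
(* Sixteen of the 28 powers make up [q ^+ d <= eps]; the other twelve beat the size of the balls. *)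
have -> : 2 * (n%:R * d.+1%:R ^+ 4 * a ^+ (28 * d)) =
    n%:R * (q ^+ d * (2 * (d.+1%:R ^+ 4 * a ^+ (12 * d)))) :> R.
  rewrite /q -a16 -exprM (_ : 28 * d = 16 * d + 12 * d)%N; last by rewrite -mulnDl.
  rewrite exprD; move: n%:R (d.+1%:R ^+ 4) (a ^+ (16 * d)) (a ^+ (12 * d)) => x y z w; ring.
apply: (fractional_arith _ _ _ _ _ qd (erefl eta) _ (HD' _ D'd)) => //.
- exact: ltW.
- have := H3 n n3; rewrite expr1 -exprM => le.
  by rewrite -ler_pdivlMl // mulr1.
- by have := H4 n n4; rewrite ler_pdivrMr // mulrC.
- by rewrite exprn_ge0 // ltW.
- by rewrite mulr_ge0 // mulr_ge0 ?exprn_ge0 // ltW.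
Qed.

Let L := ln (1 / q).

Lemma exp_q k : q ^+ k = expR (- (k%:R * L)).
Proof. by rewrite exprn_expR // /L div1r lnV ?posrE // mulrN opprK. Qed.

Lemma exp_a (a : R) k : 0 < a -> a ^+ 16 = q -> a ^+ k = expR (- (k%:R / 16 * L)).
Proof.
move=> a0 a16; rewrite exprn_expR //; congr expR.
have -> : L = - (16 * ln a).
  by rewrite /L div1r lnV ?posrE // -a16 lnXn // mulr_natl.
by field.
Qed.

(** * Mean loss of a typical pairing at logarithmic degree or more *)

Section Typical.
Variables (delta a t : R) (g : nat).
Hypotheses (delta0 : 0 < delta) (a0 : 0 < a) (a1 : a < 1) (a16 : a ^+ 16 = q).
Hypotheses (t0 : 0 < t) (g0 : (0 < g)%N) (atg : a ^+ g <= t).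
Hypothesis qa : 1 - p + p * t <= a ^+ 15.
Variables (H b n d d0 m : nat) (s : {ffun half_edge n d -> half_edge n d}).
Hypotheses (H15 : (15 <= H)%N) (Hdelta : 8 * (1 + delta) <= 7 * delta * H%:R).
Hypotheses (bdelta : 1 + delta <= b%:R).
Hypotheses (led : (d0 <= d)%N) (d0_gt0 : (0 < d0)%N) (n1 : (1 < n)%N).
Hypotheses (sP : s \in pairings n d) (typ : typical d0 (2 * g) H m s).
Hypotheses (m0 : (0 < m)%N) (mn : (6 * m * (2 * g) <= n)%N).
Hypothesis small_tail : (a ^+ 14) ^+ n <= n%:R^-1 ^+ b.
Let l : R := ln n%:R.

Let n0 : 0 < n%:R :> R. Proof. by rewrite ltr0n ltnW. Qed.
Let nE : n%:R = expR l. Proof. by rewrite lnK. Qed.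
Let l0 : 0 <= l. Proof. by rewrite ln_ge0 // ler1n ltnW. Qed.

Lemma tail_le : n%:R * n%:R^-1 ^+ b <= n%:R `^ (- (delta / 8)).
Proof.
rewrite powR_expR ?(ltnW n1) // exprn_expR ?invr_gt0 // lnV ?posrE // -/l nE -expRD ler_expR.
have h : (1 + delta) * l <= b%:R * l by rewrite ler_wpM2r.
have h' : 0 <= delta * l by rewrite mulr_ge0 // ltW.
exact: tail_arith.
Qed.

(** Repeats can cost each vertex a fraction [1 / H] of its degree. [Hdelta] states that
    [(1 - 1/H) (1 + delta) >= 1 + delta/8], which is where the exponent [delta/8] arises. *)
Lemma sum_deg_typical : d0 = d -> (1 + delta) * l <= d%:R * L ->
  \sum_v p * q ^+ deg s v <= n%:R `^ (- (delta / 8)).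
Proof.
move=> d0d dL; apply: (@le_trans _ _ (\sum_(v < n) expR (- (1 + delta / 8) * l))).
  apply: ler_sum => v _; rewrite -[leRHS]mul1r; apply: ler_pM;
    rewrite ?exprn_ge0 ?(ltW p0) ?(ltW p1) ?(ltW q0) //.
  rewrite exp_q ler_expR mulNr lerN2.
  have [u uv] : exists u, v != u.
    have /card_gt0P[u] : (0 < #|[set~ v]%SET|)%N.
      by rewrite cardsC1 card_ord -subn1 subn_gt0.
    by rewrite !inE eq_sym => uv; exists u.
  have vW : v \in [set v; u]%SET by rewrite !inE eqxx.
  have := leq_trans (leq_landing1 s led uv) (leq_add (deg_ge d0 s vW) (leqnn _)).
  have dL' : (1 + delta) * l <= d0%:R * L by rewrite d0d.
  have := repeats_lt typ uv.
  move: (repeats _ _ _) (deg s v) => r k Hr dk.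
  have {}Hr : H%:R * r%:R <= d0%:R :> R by rewrite -natrM ler_nat ltnW.
  have {}dk : d0%:R <= k%:R + r%:R :> R by rewrite -natrD ler_nat.
  have HR : 0 < H%:R :> R by rewrite ltr0n (leq_trans _ H15).
  rewrite -(ler_pM2l HR).
  have h1 : (H%:R - 1) * d0%:R <= H%:R * k%:R :> R.
    have : H%:R * d0%:R <= H%:R * (k%:R + r%:R) :> R by rewrite ler_pM2l.
    by rewrite mulrDr mulrBl mul1r => h; rewrite lerBlDr (le_trans h) // lerD2l.
  have h2 : (H%:R - 1) * d0%:R * L <= H%:R * k%:R * L by rewrite ler_pM2r.
  have H1 : 0 <= H%:R - 1 :> R by rewrite subr_ge0 ler1n (leq_trans _ H15).
  have h3 : (H%:R - 1) * ((1 + delta) * l) <= (H%:R - 1) * (d0%:R * L).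
    by rewrite ler_wpM2l.
  have h4 : 8 * (1 + delta) * l <= 7 * delta * H%:R * l by rewrite ler_wpM2r.
  rewrite [leRHS]mulrA; apply: le_trans h2; rewrite -mulrA; apply: le_trans h3.
  exact: deg_arith.
rewrite sumr_const card_ord -[leLHS]mulr_natl powR_expR ?(ltnW n1) // -/l nE -expRD ler_expR.
exact: sum_deg_arith.
Qed.

(** The balls cost at most [n^(1/2)], and [q^(7d/4) <= n^(-7(1 + delta)/4)]: the exponent is at most
    1 + 1/2 - 7/4 - 7 [delta] / 4. *)
Lemma cluster_le : d0 = d -> (1 + delta) * l <= d%:R * L -> (d0.+1 ^ 8 <= n)%N ->
  n%:R * d.+1%:R ^+ 4 * a ^+ (28 * d0) <= n%:R `^ (- (delta / 8)).
Proof.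
move=> d0d dL d8; rewrite -d0d in dL *.
have d4 : d0.+1%:R ^+ 4 <= expR (l / 2).
  rewrite -(@ler_pXn2r _ 2) ?nnegrE ?exprn_ge0 ?expR_ge0 // -exprM -expRM_natl.
  by rewrite mulrC divfK // -nE -natrX ler_nat.
apply: (@le_trans _ _ (expR l * expR (l / 2) * expR (- ((28 * d0)%:R / 16 * L)))).
  by rewrite (exp_a _ a0 a16) ler_wpM2r ?expR_ge0 // -nE ler_wpM2l.
rewrite -!expRD powR_expR ?(ltnW n1) // ler_expR -/l natrM.
have h : 0 <= delta * l by rewrite mulr_ge0 // ltW.
exact: cluster_arith.
Qed.

(** [q^(13 d0/16)] is at most [n^(-13(1 + delta)/8)], which beats the factor [n]; the doubled degree
    makes this possible. *)
Lemma low_le : 2 * (1 + delta) * l <= d0%:R * L ->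
  n%:R * a ^+ (13 * d0) <= n%:R `^ (- (delta / 8)).
Proof.
move=> dL; rewrite (exp_a _ a0 a16) powR_expR ?(ltnW n1) // -/l nE -expRD ler_expR natrM.
have h : 0 <= delta * l by rewrite mulr_ge0 // ltW.
exact: low_arith.
Qed.

(** In either range of degrees each term is at most one copy of the power of [n]; the coefficients
    add up to 1 + 2 + 4 or to 1 + 6. *)
Lemma mean_loss_typical :
  (d0 = d /\ (1 + delta) * l <= d%:R * L /\ (d0.+1 ^ 8 <= n)%N) \/
    2 * (1 + delta) * l <= d0%:R * L ->
  mean_loss p (pairing_graph s) <= 7 * n%:R `^ (- (delta / 8)).
Proof.
have tail : n%:R * a ^+ (14 * n) <= n%:R `^ (- (delta / 8)).
  by apply: le_trans tail_le; rewrite ler_pM2l // exprM.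
move: tail (tail_le); set z := _ `^ _ => tail _ [[d0d [dL d8]]|dL].
  apply: le_trans (mean_loss_le_double p0 p1 a0 a1 t0 atg qa led H15 sP typ g0 m0 mn) _.
  have h1 := sum_deg_typical d0d dL; have h2 := cluster_le d0d dL d8.
  rewrite (_ : 7 * z = z + (2 * z + 4 * z)); last by ring.
  by apply: lerD => //; apply: lerD; rewrite ler_wpM2l.
apply: le_trans (mean_loss_le_low p0 p1 a0 a1 t0 atg qa led d0_gt0 H15 sP typ g0 m0 mn n1) _.
rewrite (_ : 7 * z = z + 6 * z); last by ring.
by apply: lerD => //; rewrite ler_wpM2l // low_le.
Qed.

End Typical.

(* Up to degree K log n all half-edges are used; beyond that only the first
   K log n of each vertex, for which low vertices are already too rare to
   matter. *)
Lemma constant_loss (delta : R) : 0 < delta -> exists N : nat, forall n d : nat,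
  (N <= n)%N -> ~~ odd (n * d) -> (1 + delta) * ln n%:R / L <= d%:R ->
  cm_expectation d (fun G : rel 'I_n => mean_loss p G) <= 8 * n%:R `^ (- (delta / 8)) /\
  1 - n%:R `^ (- (delta / 16)) <=
    cm_probability d R (fun G : rel 'I_n => mean_loss p G <= n%:R `^ (- (delta / 16))).
Proof.
move=> delta0.
have [a [t [g [[a0 a1 a16] [t0 g0 atg qa]]]]] := exists_tilt p0 p1.
have gg0 : (0 < 2 * g)%N by rewrite muln_gt0.
have [H1 HH1] := exists_natr_ge (8 * (1 + delta) / (7 * delta)).
pose H := maxn 15 H1.
have H15 : (15 <= H)%N by rewrite leq_max leqnn.
have Hdelta : 8 * (1 + delta) <= 7 * delta * H%:R.
  have := HH1 H; rewrite leq_max leqnn orbT => /(_ isT).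
  by rewrite ler_pdivrMr ?mulr_gt0 // [H%:R * _]mulrC.
(* An atypical pairing may lose as much as [n], so its probability must be at most
   [n^-(1 + delta)]. *)
have [b Hb] := exists_natr_ge (1 + delta); have {}Hb := Hb _ (leqnn b).
have [M [D [C [N1 [M0 M6 MN rare]]]]] := 
  @atypical_rare R (2 * g) H b gg0 (leq_trans (isT : (0 < 15)%N) H15).
have a14 : 0 < a ^+ 14 by rewrite exprn_gt0.
have a14' : a ^+ 14 < 1 by rewrite exprn_ilt1 // ltW.
have [N2 tail] := expr_le_invn b a14 a14'.
pose K := 2 * (1 + delta) / L.
have K0 : 0 < K by rewrite divr_gt0 // mulr_gt0 // addr_gt0.
have C1 : 0 < C.+1%:R :> R by [].
have r0 : 0 < 8^-1 :> R by rewrite invr_gt0.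
have CK0 : 0 < 2 * (C.+1%:R * K) by rewrite mulr_gt0 // mulr_gt0.
have c0 : 0 < (2 * (C.+1%:R * K))^-1 by rewrite invr_gt0.
have [N3 small1] := ln_le_powR r0 c0.
have [N4 small2] := exists_powR_ge (4 * C.+1%:R) r0.
have [N5 large] := exists_natr_ge (expR (D.+1%:R * L / (1 + delta))).
have d160 : 0 < delta / 16 by rewrite divr_gt0.
have [N6 gap] := exists_powR_ge 8 d160.
exists (maxn (maxn N1 N2) (maxn (maxn N3 N4) (maxn N5 (maxn N6 2)))) => n d.
rewrite !geq_max => /and3P[/andP[n1 n2] /andP[n3 n4] /and3P[n5 n6 n2']] ev hd.
have n0 : 0 < n%:R :> R by rewrite ltr0n ltnW.
pose l : R := ln n%:R; have l0 : 0 <= l by rewrite ln_ge0 // ler1n ltnW.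
rewrite -/l ler_pdivrMr // in hd.
pose d0 := if d%:R <= K * l then d else (Num.truncn (K * l)).+1.
have Kl0 : 0 <= K * l by rewrite mulr_ge0 // ltW.
have KL : K * l * L = 2 * (1 + delta) * l.
  by rewrite mulrAC divfK // gt_eqF.
have led : (d0 <= d)%N.
  rewrite /d0; case: ifPn => //; rewrite -ltNge => lt.
  by rewrite -(ltr_nat R); apply: le_lt_trans lt; rewrite truncn_le.
have d0_le : d0%:R <= K * l + 1.
  rewrite /d0; case: ifP => [le|_]; first by apply: le_trans le _; rewrite lerDl.
  by rewrite -natr1 lerD2r truncn_le.
have d0L : (1 + delta) * l <= d0%:R * L.
  rewrite /d0; case: ifP => // _.
  apply: (@le_trans _ _ (K * l * L)).
    rewrite KL -mulrA ler_peMl ?(ler_nat R 1 2) //.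
    by rewrite mulr_ge0 // addr_ge0 // ltW.
  by rewrite ler_pM2r // ltW // truncnS_gt.
have D0 : (D < d0)%N.
  have := large n n5; rewrite -[n%:R]lnK ?posrE // ler_expR -/l.
  rewrite ler_pdivrMr ?addr_gt0 // [l * _]mulrC => le.
  by rewrite -(ler_nat R) -(ler_pM2r L0) (le_trans le).
(* Since [d0] is of order [log n], it is below any multiple of [n^(1/8)]. This covers both the
   condition of [atypical_rare] and the count of the balls. *)
have pow8 : ((C.+1 * d0.+1) ^ 8 <= n)%N.
  rewrite -(ler_nat R) natrX.
  have -> : n%:R = (n%:R `^ 8^-1) ^+ 8 :> R.
    by rewrite -powR_mulrn ?powR_ge0 // -powRrM mulVf ?powRr1 ?(ltW n0) // pnatr_eq0.
  apply: lerXn2r; rewrite ?nnegrE ?powR_ge0 //.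
  rewrite natrM -[d0.+1%:R]natr1; apply: (@le_trans _ _ (C.+1%:R * (K * l + 1 + 1))).
    by rewrite ler_wpM2l // lerD2r.
  have s1 := small1 n n3; rewrite -/l ler_pdivlMl // in s1.
  have s2 := small2 n n4.
  exact: cut_arith.
have C8 : (C * d0.+1 ^ 2 <= n)%N.
  apply: leq_trans pow8; rewrite expnMn; apply: leq_mul; last exact: leq_pexp2l.
  by rewrite (leq_trans (leqnSn C)) // -{1}(expn1 C.+1) leq_pexp2l.
have d8 : (d0.+1 ^ 8 <= n)%N.
  by apply: leq_trans pow8; rewrite expnMn leq_pmull // expn_gt0.
have bad := rare n d d0 n1 led (ltnW D0) C8.
have m0 : (0 < n %/ M)%N by rewrite divn_gt0 // (leq_trans MN).
have mn : (6 * (n %/ M) * (2 * g) <= n)%N.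
  apply: leq_trans (leq_trunc_div n M).
  by rewrite mulnC mulnA mulnC leq_mul2l mulnC M6 orbT.
have d0_gt0 : (0 < d0)%N by apply: leq_trans D0.
pose z := n%:R `^ (- (delta / 8)) : R.
have z0 : 0 <= z by apply: powR_ge0.
have good s : s \in pairings n d -> ~~ ~~ typical d0 (2 * g) H (n %/ M) s ->
    mean_loss p (pairing_graph s) <= 7 * z.
  move=> sP; rewrite negbK => typ.
  apply: (mean_loss_typical delta0 a0 a1 a16 t0 g0 atg qa H15 Hdelta Hb led
            d0_gt0 n2' sP typ m0 mn (tail n n2)).
  rewrite -/l /d0; case: ifP => [le|_]; [left | right].
    split=> //; split=> //; have := d8; rewrite /d0 le.
    by [].
  by rewrite -KL ler_pM2r // ltW // truncnS_gt.
have nb : n%:R * n%:R^-1 ^+ b <= z by apply: tail_le.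
split.
  rewrite -/z (_ : 8 * z = z + 7 * z); last by ring.
  apply: le_trans (cm_expectation_le ev (ler0n R n) _ _ good bad) _.
  - by rewrite mulr_ge0.
  - by move=> G; apply: mean_loss_le_size.
  by rewrite lerD2r.
have z16 : 8 * z <= n%:R `^ (- (delta / 16)).
  have g8 := gap n n6.
  have -> : n%:R `^ (- (delta / 16)) = n%:R `^ (delta / 16) * z.
    rewrite /z -powRD; last by rewrite (gt_eqF n0) implybT.
    by congr (_ `^ _); lra.
  by rewrite ler_wpM2r.
(* Every typical pairing satisfies the loss bound, so the failure probability is that of atypical
   pairings and Markov's inequality is avoided. *)
apply: le_trans (cm_probability_ge ev _ bad); last first.
  move=> s sP typ; apply: le_trans (good s sP typ) _; apply: le_trans z16.
  by rewrite ler_wpM2r // ler_nat.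
rewrite lerD2l lerN2; apply: le_trans z16.
apply: (@le_trans _ _ z); last by rewrite -[leLHS]mul1r ler_wpM2r // ler1n.
apply: le_trans nb; rewrite -[leLHS]mul1r ler_wpM2r ?exprn_ge0 ?invr_ge0 //.
by rewrite ler1n ltnW.
Qed.

End MainResults.

Local Open Scope classical_set_scope.
Local Open Scope ring_scope.

Theorem theorem4p3 (R : realType) (p q : R)
    (hp0 : 0 < p) (hp1 : p < 1) (hq : q = 1 - p) :
  (exists eps0 c : R, [/\ 0 < eps0, 0 < c &
     forall (eps : R) (d : nat),
       0 < eps -> eps < eps0 ->
       (ln (1 / eps) + c * eps * ln (1 / eps) ^+ 2) / ln (1 / q) <= d%:R ->
       (fun n : nat =>
          cm_probability d R (fun G : rel 'I_n => mean_loss p G <= eps * n%:R))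
         @ within (fun n : nat => ~~ odd (n * d)) \oo --> (1 : R)])
  /\
  (forall delta : R, 0 < delta ->
     exists (C : R) (N : nat), forall n d : nat,
       (N <= n)%N -> ~~ odd (n * d) ->
       (1 + delta) * ln n%:R / ln (1 / q) <= d%:R ->
       cm_expectation d (fun G : rel 'I_n => mean_loss p G)
         <= C * n%:R `^ (- (delta / 8))
       /\ 1 - C * n%:R `^ (- (delta / 16))
         <= cm_probability d R
              (fun G : rel 'I_n => mean_loss p G <= n%:R `^ (- (delta / 16)))).
Proof.
subst q; split.
  have [eps0 [c [eps00 c0 loss_le]]] := fractional_loss hp0 hp1.
  exists eps0, c; split=> // eps d eps_gt0 eps_lt hd.
  apply/cvgrPdist_le => e e0.
  have [N HN] := loss_le eps d eps_gt0 eps_lt hd e e0.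
  exists N => // n /= nN ev.
  rewrite ger0_norm ?subr_ge0 ?cm_probability_le1 //.
  by rewrite lerBlDl -lerBlDr HN.
move=> delta delta0; have [N HN] := constant_loss hp0 hp1 delta0.
exists 8, N => n d nN ev hd; have [E P] := HN n d nN ev hd; split=> //.
apply: le_trans P; rewrite lerD2l lerN2 -[leLHS]mul1r ler_wpM2r ?powR_ge0 //.
by rewrite ler1n.
Qed.
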